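(* Let $(y_t)$ be generated by the ARFIMA model described in the context, with true parameter $\boldsymbol{\eta}_0=(\boldsymbol{\theta}_0^{\mathsf T},d_0)^{\mathsf T}\in\Pi\times D$, and suppose the innovations $(\varepsilon_t)$ satisfy condition (A1) of the context. Then, for any $\delta>0$ such that $(\Pi\times D)\setminus B_\delta(\boldsymbol{\eta}_0)\neq\varnothing$, any $q>0$ and any $\theta>0$, $$\mathrm{E}\left[\left\{\inf_{\boldsymbol{\eta}\in(\Pi\times D)\setminus B_\delta(\boldsymbol{\eta}_0)}a_n^{-1}(d)\sum_{t=1}^n\big(\varepsilon_t(\boldsymbol{\eta})-\varepsilon_t(\boldsymbol{\eta}_0)\big)^2\right\}^{-q}\right]=O\big((\log n)^\theta\big)\qquad(n\to\infty),$$ where $d$ denotes the last coordinate of $\boldsymbol{\eta}$ and $$a_n(d)=n\,I_{\{d\ge d_0-1/2\}}+n^{2(d_0-d)}I_{\{d<d_0-1/2\}} .$$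
   Context: Model. $p_1,p_2$ are fixed nonnegative integers (coefficients and conditions involving a block of size zero are omitted), $\bar p=p_1+p_2+1$. The $\varepsilon_t$, $t\ge1$, are independent random variables with $\mathrm{E}(\varepsilon_t)=0$ and $\mathrm{E}(\varepsilon_t^2)=\sigma^2<\infty$ for all $t\ge1$. $B$ is the back-shift operator and $y_t=\varepsilon_t=0$ for all $t\le 0$. For $\boldsymbol{\theta}=(\alpha_1,\ldots,\alpha_{p_1},\beta_1,\ldots,\beta_{p_2})^{\mathsf T}$ put $A_{1,\boldsymbol{\theta}}(z)=1-\sum_{j=1}^{p_1}\alpha_jz^j$ and $A_{2,\boldsymbol{\theta}}(z)=1-\sum_{j=1}^{p_2}\beta_jz^j$. The data satisfy $$A_{1,\boldsymbol{\theta}_0}(B)(1-B)^{d_0}y_t=A_{2,\boldsymbol{\theta}_0}(B)\varepsilon_t ,\quad t\ge1,$$ with unknown $\boldsymbol{\eta}_0=(\boldsymbol{\theta}_0^{\mathsf T},d_0)^{\mathsf T}\in\Pi\times D$. Operators such as $(1-B)^d$ (for real $d$) and $A_{2,\boldsymbol{\theta}}^{-1}(B)$ are defined by substituting $B$ for $z$ in the power series expansion at $0$ of $(1-z)^d$, $1/A_{2,\boldsymbol{\theta}}(z)$. Parameter space. $D=[L,U]$ with $-\infty<L<U<\infty$, and $\Pi$ is a compact subset of $\mathbb{R}^{p_1+p_2}$ each of whose elements $\boldsymbol{\theta}$ satisfies: $A_{1,\boldsymbol{\theta}}(z)\ne0$ and $A_{2,\boldsymbol{\theta}}(z)\neq0$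 for all $|z|\le1$; $A_{1,\boldsymbol{\theta}}$ and $A_{2,\boldsymbol{\theta}}$ have no common zeros; $|\alpha_{p_1}|+|\beta_{p_2}|>0$. Notation. For $\boldsymbol{\eta}=(\boldsymbol{\theta}^{\mathsf T},d)^{\mathsf T}$, $\varepsilon_t(\boldsymbol{\eta})=A_{1,\boldsymbol{\theta}}(B)A_{2,\boldsymbol{\theta}}^{-1}(B)(1-B)^dy_t$ (so $\varepsilon_t(\boldsymbol{\eta}_0)=\varepsilon_t$). $B_\delta(\boldsymbol{\eta}_0)=\{\boldsymbol{\eta}\in\mathbb{R}^{\bar p}:\|\boldsymbol{\eta}-\boldsymbol{\eta}_0\|<\delta\}$ with $\|\cdot\|$ the Euclidean norm; $I$ denotes an indicator. Condition (A1). There exist $0<\delta_0\le1$, $0<\alpha_0\le1$, $0<M_1<\infty$ such that for all real $s,v$ with $0<s-v\le\delta_0$, $$\sup_{1\le t<\infty,\ \|\mathbf v_t\|=1}|F_{t,\mathbf v_t}(s)-F_{t,\mathbf v_t}(v)|\le M_1(s-v)^{\alpha_0},$$ where $\mathbf v_t$ ranges over $t$-dimensional real vectors and $F_{t,\mathbf v_t}$ is the distribution function of $\mathbf v_t^{\mathsf T}(\varepsilon_t,\ldots,\varepsilon_1)^{\mathsf T}$. *)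

(* Defs.v *)
From HB Require Import structures.
From mathcomp Require Import all_boot all_order all_algebra.
From mathcomp Require Import complex.
From mathcomp Require Import all_classical all_reals all_analysis.
From mathcomp Require Import measurable_realfun.

Set Implicit Arguments.
Unset Strict Implicit.
Unset Printing Implicit Defensive.
Import Order.TTheory GRing.Theory Num.Theory.
Import numFieldNormedType.Exports.

Local Open Scope classical_set_scope.
Local Open Scope ring_scope.

(* The library norm on 'rV[R]_n is the sup norm. *)
Definition enorm (R : realType) (n : nat) (v : 'rV[R]_n) : R :=
  Num.sqrt (\sum_i v 0 i ^+ 2).

Section Operators.
Variable R : realType.

(* [filt g x] is g(B) x for g(z) = \sum_j g_j z^j: sequences carry the values
   at times t >= 1 and vanish at times t <= 0, so the terms with j >= t drop
   out. The entry of [x] at index 0 is never used. *)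
Definition filt (g x : nat -> R) (t : nat) : R :=
  \sum_(j < t) g j * x (t - j)%N.

(* Binomial series: (1 - z)^d = \sum_j (-1)^j binom(d, j) z^j. *)
Definition frac_coef (d : R) (j : nat) : R :=
  \prod_(i < j) ((i%:R - d) / i.+1%:R).

(* Coefficients of 1 / A(z) when A(0) = 1, by the geometric series
   1 / A = \sum_k (1 - A)^k; the k-th term is divisible by z^k. *)
Definition inv_coef (A : {poly R}) (j : nat) : R :=
  \sum_(k < j.+1) ((1 - A) ^+ k)`_j.

Lemma derive1n_frac (d : R) (j : nat) (z : R) : z < 1 ->
  derive1n j (fun z : R => (1 - z) `^ d) z =
  \prod_(i < j) (i%:R - d) * (1 - z) `^ (d - j%:R).
Proof.
elim: j z => [|j IH] z z1; first by rewrite big_ord0 mul1r subr0.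
rewrite derive1nS derive1E; apply: derive_val.
have nz : \near z, \prod_(i < j) (i%:R - d) * (1 - z) `^ (d - j%:R) =
    derive1n j (fun z : R => (1 - z) `^ d) z.
  near=> w; rewrite IH//; near: w; exact: lt_nbhsl.
apply: (near_eq_is_derive nz).
rewrite big_ord_recr/=.
set c := \prod_(i < j) _.
have h0 : 0 < 1 - z by rewrite subr_gt0.
have h1 : is_derive z 1 (fun z : R => 1 - z) (-1).
  by apply: is_derive_eq; rewrite add0r mul1r.
have h2 := is_derive1_powR (d - j%:R) h0.
have h3 := @is_derive1_comp _ (fun x => x `^ (d - j%:R)) (fun z => 1 - z) z _ _ h2 h1.
apply: is_derive_eq.
rewrite /GRing.scale/= mulrN1 -natr1 opprD addrA.
by rewrite -mulrA; congr (_ * _); rewrite -mulNr opprB.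
Unshelve. all: by end_near.
Qed.

Lemma frac_coef_taylor (d : R) (j : nat) :
  frac_coef d j = derive1n j (fun z : R => (1 - z) `^ d) 0 / j`!%:R.
Proof.
rewrite derive1n_frac ?ltr01// subr0 powR1 mulr1 /frac_coef.
rewrite big_split/= prodfV; congr (_ / _).
elim: j => [|j IH]; first by rewrite big_ord0.
by rewrite big_ord_recr/= IH -natrM mulnC factS.
Qed.

Lemma inv_coefP (A : {poly R}) (j : nat) : A`_0 = 1 ->
  \sum_(i < j.+1) A`_i * inv_coef A (j - i) = (j == 0%N)%:R.
Proof.
move=> A0.
have ck k m : (m < k)%N -> ((1 - A) ^+ k)`_m = 0.
  move=> mk; have /factor_theorem[B ->] : root (1 - A) 0.
    by rewrite /root horner_coef0 coefB coef1 A0 subrr.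
  by rewrite subr0 exprMn coefMXn mk.
transitivity (A * \sum_(k < j.+1) (1 - A) ^+ k)`_j.
  rewrite coefM; apply: eq_bigr => i _; congr (_ * _).
  rewrite coef_sum /inv_coef.
  rewrite (big_ord_widen j.+1 (fun k => ((1 - A) ^+ k)`_(j - i))) ?ltnS ?leq_subr//.
  rewrite [RHS](bigID (fun k : 'I_j.+1 => (k < (j - i).+1)%N))/=.
  by rewrite [X in _ = _ + X]big1 ?addr0// => k; rewrite -leqNgt; exact: ck.
have -> : A * \sum_(k < j.+1) (1 - A) ^+ k = 1 - (1 - A) ^+ j.+1.
  by rewrite -[RHS]opprB subrX1 addrAC subrr sub0r mulNr opprK.
by rewrite coefB ck// subr0 coef1.
Qed.

End Operators.

Section Model.
Variables (R : realType) (p1 p2 : nat).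

Definition ar_poly (theta : 'rV[R]_(p1 + p2)) : {poly R} :=
  1 - \sum_(j < p1) theta 0 (lshift p2 j) *: 'X^(j.+1).

Definition ma_poly (theta : 'rV[R]_(p1 + p2)) : {poly R} :=
  1 - \sum_(j < p2) theta 0 (rshift p1 j) *: 'X^(j.+1).

Definition croot (A : {poly R}) (z : R[i]) : bool :=
  root (map_poly (real_complex R) A) z.

(* The last clause is |alpha_p1| + |beta_p2| > 0; it is void when a block is
   empty. *)
Definition admissible (theta : 'rV[R]_(p1 + p2)) : Prop :=
  [/\ forall z : R[i], `|z| <= 1 -> ~~ croot (ar_poly theta) z,
      forall z : R[i], `|z| <= 1 -> ~~ croot (ma_poly theta) z,
      forall z : R[i], ~ (croot (ar_poly theta) z /\ croot (ma_poly theta) z)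
    & forall (i : 'I_p1) (j : 'I_p2), i.+1 = p1 -> j.+1 = p2 ->
        0 < `|theta 0 (lshift p2 i)| + `|theta 0 (rshift p1 j)| ].

Definition theta_of (eta : 'rV[R]_(p1 + p2 + 1)) : 'rV[R]_(p1 + p2) :=
  lsubmx eta.

Definition d_of (eta : 'rV[R]_(p1 + p2 + 1)) : R := rsubmx eta 0 0.

Definition param_space (Pi : set 'rV[R]_(p1 + p2)) (L U : R) :
    set 'rV[R]_(p1 + p2 + 1) :=
  [set eta | Pi (theta_of eta) /\ L <= d_of eta <= U].

Definition eball (eta0 : 'rV[R]_(p1 + p2 + 1)) (delta : R) :
    set 'rV[R]_(p1 + p2 + 1) :=
  [set eta | enorm (eta - eta0) < delta].

Definition arfima (eta : 'rV[R]_(p1 + p2 + 1)) (y e : nat -> R) : Prop :=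
  forall t, (1 <= t)%N ->
    filt (fun j => (ar_poly (theta_of eta))`_j)
      (filt (frac_coef (d_of eta)) y) t =
    filt (fun j => (ma_poly (theta_of eta))`_j) e t.

Definition residual (eta : 'rV[R]_(p1 + p2 + 1)) (y : nat -> R) : nat -> R :=
  filt (fun j => (ar_poly (theta_of eta))`_j)
    (filt (inv_coef (ma_poly (theta_of eta)))
      (filt (frac_coef (d_of eta)) y)).

Definition rate (d0 : R) (n : nat) (d : R) : R :=
  if d0 - 2^-1 <= d then n%:R else n%:R `^ (2 * (d0 - d)).

Definition scaled_inf (K : set 'rV[R]_(p1 + p2 + 1))
    (eta0 : 'rV[R]_(p1 + p2 + 1)) (y : nat -> R) (n : nat) : \bar R :=
  ereal_inf [set ((rate (d_of eta0) n (d_of eta))^-1 *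
      \sum_(1 <= t < n.+1) (residual eta y t - residual eta0 y t) ^+ 2)%:E
    | eta in K].

End Model.

Section Innovations.
Context {disp : measure_display} {T : measurableType disp} {R : realType}.
Variable P : probability T R.

Definition independent_innovations (eps : nat -> {RV P >-> R}) : Prop :=
  forall s : seq nat, uniq s -> all (leq 1) s ->
  forall E : nat -> set R, (forall t, measurable (E t)) ->
    (P (\bigcap_(t in [set` s]) (eps t @^-1` E t)) =
      \prod_(t <- s) P (eps t @^-1` E t))%E.

(* v^T (eps_t, ..., eps_1)^T *)
Definition lincomb (eps : nat -> {RV P >-> R}) (t : nat) (v : 'rV[R]_t)
    (w : T) : R :=
  \sum_(i < t) v 0 i * eps (t - i)%N w.

Lemma measurable_lincomb eps t (v : 'rV[R]_t) :
  measurable_fun [set: T] (lincomb eps v).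
Proof.
by apply: measurable_sum => i; exact: measurable_funM.
Qed.

HB.instance Definition _ eps t (v : 'rV[R]_t) :=
  isMeasurableFun.Build _ _ _ _ (lincomb eps v) (measurable_lincomb eps v).

Definition lincomb_cdf (eps : nat -> {RV P >-> R}) (t : nat) (v : 'rV[R]_t) :
    R -> \bar R :=
  cdf (lincomb eps v : {RV P >-> R}).

Definition condition_A1 (eps : nat -> {RV P >-> R}) : Prop :=
  exists delta0 alpha0 M1 : R,
    [/\ 0 < delta0 <= 1, 0 < alpha0 <= 1, 0 < M1 &
        forall s v : R, 0 < s - v <= delta0 ->
          (ereal_sup [set x : \bar R | exists (t : nat) (u : 'rV[R]_t),
             [/\ (1 <= t)%N, enorm u = 1%R &
                 x = `|lincomb_cdf eps u s - lincomb_cdf eps u v|]]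
           <= (M1 * (s - v) `^ alpha0)%:E)%E].

End Innovations.

(* Main.v *)
Require Import Defs.
From HB Require Import structures.
From mathcomp Require Import all_boot all_order all_algebra.
From mathcomp Require Import complex.
From mathcomp Require Import all_classical all_reals all_analysis.
From mathcomp Require Import measurable_realfun.
From mathcomp Require Import ring lra zify.
Import Order.TTheory GRing.Theory Num.Theory.
Import numFieldNormedType.Exports.
Local Open Scope classical_set_scope.
Local Open Scope ring_scope.
Set Implicit Arguments.
Unset Strict Implicit.
Unset Printing Implicit Defensive.

(* Write u = (1 - B)^(d - d0) eps. The difference eps_t(eta) - eps_t is a linear
   filter b(eta) - 1 of the innovations, where b(eta) is an l^1-invertible
   short-memory filter applied to (1 - B)^(d - d0).

   Lower bound for a fixed eta. Since the short-memory part has an inverse of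
   bounded l^1 norm, Young's inequality bounds the energy of the first m
   coefficients of b(eta) - 1 below by c m^max(0, 2(d0 - d) - 1); identifiability
   and compactness take care of the constant. Hence at k times spaced by n/(k+1)
   the process is conditionally spread out on the right scale, and (A1) gives
   P(a_n^-1 sum <= x) <= C x^(alpha k / 2) for any fixed k.

   Uniformity in eta. Changing d by h multiplies by the filter (1 - B)^h, whose
   distance to 1 in l^1 on [0, n] is O(|h| log n) for |h| <= 1/log n; so the
   normalized sums are Lipschitz in eta up to a power of log n and a random
   factor of mean O((log n)^2), and a net of size polynomial in log n and 1/x
   suffices. For x <= (log n)^-theta' with theta' > 0 arbitrary, log n is bounded
   by a power of 1/x, so a large fixed k makes P(inf <= x) = O(x^Q) for any Q.
   Integrating this tail gives O((log n)^(q theta')). *)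

(** * Formal power series *)

(** Filters with d < d0 need not be summable, so every norm is truncated at a finite length.
    Coefficient n of a product involves only coefficients up to n, which makes the truncated l^1
    norm submultiplicative; algebra then takes place in the ring of formal power series, without
    convergence questions.

    The infimum runs over an uncountable set and is never shown to be measurable. The tail estimate
    therefore supplies measurable events containing {inf < 1/z}, and the inverse moment is bounded
    by a measurable majorant built from these events at dyadic levels z.

    The parameters are chosen backwards. Dyadic levels start at (log n)^(kappa/q), whose q-th power
    is the allowed rate. The decay Q comes from q alone, the power J relating log n to z from
    q/kappa, the size of the net from Q and J, and the number k of conditioning times last. This
    works because the exponent alpha gained per conditioning time depends only on (A1). *)

Definition fps (R : Type) := nat -> R.

(** Only the additive structure is copied from functions, so that [*] can be the Cauchy product
    instead of a pointwise one. *)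
HB.instance Definition _ (R : zmodType) := GRing.Zmodule.copy (fps R) (nat -> R).

Section FpsRing.
Variable R : comNzRingType.
Implicit Types (f g h : fps R) (p q : {poly R}).

Definition fps_mul f g : fps R := fun n => \sum_(i < n.+1) f i * g (n - i)%N.
Definition fps_one : fps R := fun n => (n == 0%N)%:R.
Definition pser p : fps R := fun n => p`_n.
Definition ptrunc (N : nat) f : {poly R} := \poly_(i < N) f i.

(** Truncation lets commutativity and associativity be inherited from polynomials. *)
Lemma fps_mul_trunc N f g n : (n < N)%N ->
  fps_mul f g n = (ptrunc N f * ptrunc N g)`_n.
Proof.
move=> nN; rewrite coefM; apply: eq_bigr => i _.
rewrite !coef_poly (leq_ltn_trans _ nN) ?(leq_ltn_trans (leq_subr _ _) nN)//.
by rewrite -ltnS.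
Qed.

Lemma fps_mulC : commutative fps_mul.
Proof.
by move=> f g; apply/funext => n; rewrite !(@fps_mul_trunc n.+1)// mulrC.
Qed.

Lemma fps_mulA : associative fps_mul.
Proof.
have H f g h n : fps_mul (fps_mul f g) h n =
    (ptrunc n.+1 f * ptrunc n.+1 g * ptrunc n.+1 h)`_n.
  rewrite coefM; apply: eq_bigr => i _.
  by rewrite (@fps_mul_trunc n.+1)// [in RHS]coef_poly ltnS leq_subr.
move=> f g h; apply/funext => n.
by rewrite fps_mulC !H mulrC mulrA.
Qed.

Lemma fps_mul1 : left_id fps_one fps_mul.
Proof.
move=> f; apply/funext => n; rewrite /fps_mul big_ord_recl big1 ?addr0.
  by rewrite mul1r subn0.
by move=> i _; rewrite mul0r.
Qed.

Lemma fps_mulDl : left_distributive fps_mul +%R.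
Proof.
move=> f g h; apply/funext => n.
rewrite [RHS](_ : _ = fps_mul f h n + fps_mul g h n)// /fps_mul -big_split/=.
by apply: eq_bigr => i _; rewrite -mulrDl.
Qed.

Lemma fps_one_neq0 : fps_one != 0.
Proof. by apply/eqP => /(congr1 (@^~ 0%N)) /eqP; rewrite oner_eq0. Qed.

HB.instance Definition _ := GRing.Zmodule_isComNzRing.Build (fps R)
  fps_mulA fps_mulC fps_mul1 fps_mulDl fps_one_neq0.

Lemma fpsD f g n : (f + g) n = f n + g n. Proof. by []. Qed.
Lemma fpsB f g n : (f - g) n = f n - g n. Proof. by []. Qed.
Lemma fpsM f g n : (f * g) n = \sum_(i < n.+1) f i * g (n - i)%N.
Proof. by []. Qed.
Lemma fps1 n : (1 : fps R) n = (n == 0%N)%:R. Proof. by []. Qed.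
Lemma fpsM0 f g : (f * g) 0%N = f 0%N * g 0%N.
Proof. by rewrite fpsM big_ord1. Qed.

Lemma pserM p q : pser (p * q) = pser p * pser q.
Proof. by apply/funext => n; rewrite /pser coefM. Qed.

Lemma pser1 : pser 1 = 1.
Proof. by apply/funext => n; rewrite /pser coef1 fps1. Qed.

Lemma pser_inj : injective pser.
Proof. by move=> p q e; apply/polyP => i; have /(congr1 (@^~ i)) := e. Qed.

End FpsRing.

(** * Filters as products of power series *)

Definition fshift (R : Type) (x : nat -> R) : fps R := fun n => x n.+1.

Section Filt.
Variable R : realType.
Implicit Types (f g : fps R) (x : nat -> R).

(** Times start at 1 and exponents at 0. After the shift [filt] is exactly a product, so composing
    and inverting filters becomes ring algebra. *)
Lemma filtE g x t : filt g x t.+1 = (g * fshift x) t.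
Proof.
rewrite /filt fpsM; apply: eq_bigr => i _.
by rewrite /fshift subSn// -ltnS.
Qed.

Lemma fshift_filt g x : fshift (filt g x) = g * fshift x.
Proof. by apply/funext => t; rewrite /fshift filtE. Qed.

Lemma pser_inv_coef (A : {poly R}) : A`_0 = 1 ->
  pser A * (inv_coef A : fps R) = 1.
Proof.
by move=> A0; apply/funext => n; rewrite fpsM fps1 -(inv_coefP n A0).
Qed.

Lemma frac_coef0 (d : R) : frac_coef d 0 = 1.
Proof. by rewrite /frac_coef big_ord0. Qed.

Lemma frac_coefS (d : R) j :
  frac_coef d j.+1 * j.+1%:R = (j%:R - d) * frac_coef d j.
Proof.
rewrite /frac_coef big_ord_recr/= -mulrA divfK ?pnatr_eq0// mulrC//.
Qed.

(** Vandermonde's identity, by the product rule on coefficients: the weight n + 1 is split as i + (n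
    + 1 - i), and [frac_coefS] applied to either factor yields the recursion for the exponent a +
    b. *)
Lemma frac_coefD (a b : R) :
  (frac_coef a : fps R) * frac_coef b = frac_coef (a + b).
Proof.
apply/funext => n; elim: n => [|n IH].
  by rewrite fpsM big_ord1 !frac_coef0 mulr1.
apply: (@mulIf _ n.+1%:R); first by rewrite pnatr_eq0.
rewrite frac_coefS -IH fpsM mulr_suml.
have -> : \sum_(i < n.+2) frac_coef a i * frac_coef b (n.+1 - i) * n.+1%:R =
    \sum_(i < n.+2) (frac_coef a i * i%:R) * frac_coef b (n.+1 - i) +
    \sum_(i < n.+2) frac_coef a i * (frac_coef b (n.+1 - i) * (n.+1 - i)%:R).
  rewrite -big_split/=; apply: eq_bigr => i _.
  rewrite natrB; last by rewrite -ltnS.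
  by ring.
rewrite big_ord_recl/= mulr0 mul0r add0r [X in _ + X]big_ord_recr/= subnn mulr0.
rewrite mulr0 addr0 -big_split/= fpsM mulr_sumr; apply: eq_bigr => i _.
rewrite /bump/= add1n subSS subSn; last by rewrite -ltnS.
rewrite !frac_coefS natrB; last by rewrite -ltnS.
by ring.
Qed.

Lemma frac_coef00 : (frac_coef 0 : fps R) = 1.
Proof.
apply/funext => -[|j]; first by rewrite frac_coef0 fps1.
by rewrite /frac_coef big_ord_recl/= subr0 mul0r mul0r fps1.
Qed.

End Filt.

(** * Truncated l^1 and l^2 norms, and the coefficients of (1 - z)^d *)

Lemma fps_psum (R : comNzRingType) (f g : fps R) n :
  \sum_(k < n) (f * g) k = \sum_(i < n) f i * \sum_(j < n - i) g j.
Proof.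
elim: n => [|n IH]; first by rewrite !big_ord0.
rewrite big_ord_recr/= IH fpsM.
rewrite [RHS](eq_bigr (fun i : 'I_n.+1 =>
    f i * \sum_(j < n - i) g j + f i * g (n - i)%N)); last first.
  by move=> i _; rewrite subSn -1?ltnS// big_ord_recr/= mulrDr.
by rewrite big_split/= [X in _ = X + _]big_ord_recr/= subnn big_ord0 mulr0 addr0.
Qed.

Section L1.
Variable R : numDomainType.
Implicit Types f g : fps R.

Definition l1 n f : R := \sum_(i < n) `|f i|.

Lemma l1_ge0 n f : 0 <= l1 n f.
Proof. by apply: sumr_ge0. Qed.

Lemma l1D n f g : l1 n (f + g) <= l1 n f + l1 n g.
Proof. by rewrite -big_split/=; apply: ler_sum => i _; exact: ler_normD. Qed.

Lemma le_l1 m n f : (m <= n)%N -> l1 m f <= l1 n f.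
Proof.
move=> mn; rewrite /l1 (big_ord_widen n (fun i => `|f i|) mn) big_mkcond/=.
by apply: ler_sum => i _; case: ifP.
Qed.

Lemma ler_coef_l1 n i f : (i < n)%N -> `|f i| <= l1 n f.
Proof.
by move=> i_n; rewrite /l1 (bigD1 (Ordinal i_n))//= lerDl sumr_ge0.
Qed.

Lemma l11 n : l1 n (1 : fps R) <= 1.
Proof.
case: n => [|n]; first by rewrite /l1 big_ord0.
by rewrite /l1 big_ord_recl/= normr1 big1 ?addr0// => i _; rewrite fps1 normr0.
Qed.

Lemma psum_mul_le n (a g : fps R) : (forall i, 0 <= a i) -> (forall i, 0 <= g i) ->
  \sum_(k < n) (a * g) k <= (\sum_(i < n) a i) * \sum_(j < n) g j.
Proof.
move=> a0 g0; rewrite fps_psum mulr_suml; apply: ler_sum => i _.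
rewrite ler_wpM2l// (big_ord_widen n g (leq_subr _ _)) big_mkcond/=.
by apply: ler_sum => j _; case: ifP.
Qed.

Lemma l1M n f g : l1 n (f * g) <= l1 n f * l1 n g.
Proof.
apply: le_trans (psum_mul_le n (a := fun i => `|f i|) (g := fun i => `|g i|) _ _) => //.
apply: ler_sum => k _; rewrite !fpsM; apply: le_trans (ler_norm_sum _ _ _) _.
by apply: ler_sum => i _; rewrite normrM.
Qed.

Lemma l1X n m f : (0 < n)%N -> l1 n (f ^+ m) <= l1 n f ^+ m.
Proof.
move=> n0; elim: m => [|m IH]; first by rewrite !expr0 l11.
rewrite !exprS; apply: le_trans (l1M _ _ _) _.
by rewrite ler_wpM2l// l1_ge0.
Qed.

End L1.

Section Sq.
Variable R : realType.
Implicit Types f g x : fps R.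

Definition sq n f : R := \sum_(i < n) f i ^+ 2.

Lemma sq_ge0 n f : 0 <= sq n f.
Proof. by apply: sumr_ge0 => i _; exact: sqr_ge0. Qed.

Lemma le_sq m n f : (m <= n)%N -> sq m f <= sq n f.
Proof.
move=> mn; rewrite /sq (big_ord_widen n (fun i => f i ^+ 2) mn) big_mkcond/=.
by apply: ler_sum => i _; case: ifP => // _; exact: sqr_ge0.
Qed.

Lemma sqD n f g : sq n (f + g) <= 2 * sq n f + 2 * sq n g.
Proof.
rewrite !mulr_sumr -big_split/=; apply: ler_sum => i _; rewrite fpsD.
rewrite -subr_ge0 (_ : _ - _ = (f i - g i) ^+ 2) ?sqr_ge0//; ring.
Qed.

(** Weighted Cauchy-Schwarz: twice the difference of the sides is the double sum of a_i a_j (y_i -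
    y_j)^2. *)
Lemma sum_sqr_le (I : finType) (a y : I -> R) : (forall i, 0 <= a i) ->
  (\sum_i a i * y i) ^+ 2 <= (\sum_i a i) * \sum_i a i * y i ^+ 2.
Proof.
move=> a0; rewrite -(ler_pM2l (ltr0n R 2)) expr2 mulr_suml [leLHS]mulr_sumr.
rewrite [leRHS](_ : _ = \sum_i \sum_j a i * a j * (y i ^+ 2 + y j ^+ 2)).
  apply: ler_sum => i _; rewrite !mulr_sumr; apply: ler_sum => j _.
  rewrite -subr_ge0 (_ : _ - _ = a i * a j * (y i - y j) ^+ 2); last by ring.
  by rewrite mulr_ge0 ?sqr_ge0 ?mulr_ge0 ?a0.
under [RHS]eq_bigr do rewrite (eq_bigr _ (fun j _ => mulrDr _ _ _)) big_split/=.
rewrite big_split/= [X in _ = _ + X](_ : _ = \sum_i a i * \sum_j a j * y j ^+ 2).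
  rewrite [X in _ = X + _](_ : _ = \sum_i a i * \sum_j a j * y j ^+ 2).
    by rewrite -mulr_suml; ring.
  rewrite exchange_big/=; apply: eq_bigr => i _; rewrite mulr_sumr.
  by apply: eq_bigr => j _; ring.
by apply: eq_bigr => i _; rewrite mulr_sumr; apply: eq_bigr => j _; rewrite mulrA.
Qed.

(* Young's convolution inequality. *)
Lemma sqM n f x : sq n (f * x) <= l1 n f ^+ 2 * sq n x.
Proof.
pose a : fps R := fun i => `|f i|; pose g : fps R := fun i => x i ^+ 2.
have h : \sum_(k < n) (a * g) k <= l1 n f * sq n x.
  by apply: psum_mul_le => i; rewrite /a/g ?sqr_ge0.
apply: (@le_trans _ _ (l1 n f * \sum_(k < n) (a * g) k)); last first.
  by rewrite expr2 -mulrA ler_wpM2l// l1_ge0.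
rewrite mulr_sumr; apply: ler_sum => k _; rewrite !fpsM.
apply: (@le_trans _ _ ((\sum_(i < k.+1) a i * `|x (k - i)%N|) ^+ 2)).
  rewrite -real_normK ?num_real// lerXn2r ?nnegrE ?sumr_ge0//.
    by move=> i _; rewrite /a mulr_ge0.
  by apply: le_trans (ler_norm_sum _ _ _) _; apply: ler_sum => i _; rewrite normrM.
apply: le_trans (@sum_sqr_le _ (fun i : 'I_k.+1 => a i) (fun i => `|x (k - i)%N|) _) _.
  by move=> i; rewrite /a.
rewrite [X in _ * X <= _](eq_bigr (fun i : 'I_k.+1 => a i * g (k - i)%N)); last first.
  by move=> i _; rewrite real_normK ?num_real.
rewrite ler_wpM2r//; first by apply: sumr_ge0 => i _; rewrite /a /g mulr_ge0// sqr_ge0.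
exact: le_l1.
Qed.

Lemma psum_sqr_le n f : (\sum_(i < n) f i) ^+ 2 <= n%:R * sq n f.
Proof.
have := @sum_sqr_le 'I_n (fun=> 1) (fun i => f i) (fun=> ler01).
rewrite sumr_const card_ord -mulr_natl mulr1.
by under eq_bigr do rewrite mul1r; under [X in _ <= _ * X -> _]eq_bigr do rewrite mul1r.
Qed.

End Sq.

Section Frac.
Variable R : realType.
Implicit Types (h k : R) (n : nat).
Local Notation frac h := (frac_coef h : fps R).

Lemma inv_le_lnB (j : nat) : j.+2%:R^-1 <= ln j.+2%:R - ln j.+1%:R :> R.
Proof.
have -> : ln j.+2%:R - ln j.+1%:R = - ln (1 + - j.+2%:R^-1) :> R.
  have -> : 1 + - j.+2%:R^-1 = j.+1%:R / j.+2%:R :> R.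
    by rewrite -[X in X / _](addrK 1) natr1 mulrBl divff ?pnatr_eq0// mul1r.
  by rewrite ln_div ?posrE ?ltr0n// opprB.
rewrite lerNr; apply: le_ln1Dx.
by rewrite ltrN2 invf_lt1 ?ltr0n// ltr1n.
Qed.

Lemma sum_inv_le n : \sum_(j < n.+1) j.+1%:R^-1 <= 1 + ln n.+1%:R :> R.
Proof.
elim: n => [|n IH]; first by rewrite big_ord1 invr1 ln1 addr0.
rewrite big_ord_recr/=; apply: le_trans (lerD IH (inv_le_lnB n)) _.
by rewrite -addrA [ln n.+1%:R + _]addrC subrK.
Qed.

(** The factor i = 0 of the product gives |h|, and each later one is at most 1 + |h|/i <= e^(|h|/i).
    Keeping |h| outside the exponential is what makes (1 - z)^h close to 1 for small h. *)
Lemma frac_coef_bound h j :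
  `|frac h j.+1| * j.+1%:R <= `|h| * expR (`|h| * (1 + ln j.+1%:R)).
Proof.
apply: (@le_trans _ _ (`|h| * expR (`|h| * \sum_(i < j) i.+1%:R^-1))); last first.
  rewrite ler_wpM2l// ler_expR ler_wpM2l//; apply: le_trans (sum_inv_le j).
  by rewrite big_ord_recr/= lerDl invr_ge0.
elim: j => [|j IH].
  by rewrite big_ord0 mulr0 expR0 !mulr1 /frac_coef big_ord1 sub0r divr1 normrN.
have -> : `|frac h j.+2| * j.+2%:R = `|j.+1%:R - h| * `|frac h j.+1|.
  by rewrite -normrM -frac_coefS normrM normr_nat.
apply: (@le_trans _ _ ((1 + `|h| / j.+1%:R) * (`|frac h j.+1| * j.+1%:R))).
  rewrite [leRHS]mulrCA [leLHS]mulrC ler_wpM2l//.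
  rewrite mulrDl mul1r divfK ?pnatr_eq0//.
  by apply: le_trans (ler_normB _ _) _; rewrite normr_nat.
rewrite big_ord_recr/= mulrDr expRD [leRHS]mulrA [leRHS]mulrC.
by rewrite ler_pM// ?mulr_ge0// ?expR_ge1Dx// addr_ge0// divr_ge0.
Qed.

(* The truncation [n] enters only through [1 + ln n]: filtering by
   (1 - z)^h is close to the identity as soon as |h| ln n is small. *)
Lemma l1_frac_sub1 h n :
  l1 n.+1 (frac h - 1) <=
  `|h| * expR (`|h| * (1 + ln n.+1%:R)) * (1 + ln n.+1%:R).
Proof.
rewrite /l1 big_ord_recl/= fpsB frac_coef0 fps1 subrr normr0 add0r.
apply: (@le_trans _ _ (`|h| * expR (`|h| * (1 + ln n.+1%:R)) *
    \sum_(j < n) j.+1%:R^-1)); last first.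
  rewrite ler_wpM2l ?mulr_ge0 ?expR_ge0//; apply: le_trans (sum_inv_le n).
  by rewrite big_ord_recr/= lerDl invr_ge0.
rewrite mulr_sumr; apply: ler_sum => j _.
rewrite fpsB fps1 /bump/= add1n subr0 -ler_pdivrMr ?invr_gt0 ?ltr0n// invrK.
apply: le_trans (frac_coef_bound h j) _.
rewrite ler_wpM2l// ler_expR ler_wpM2l// lerD2l ler_ln ?posrE ?ltr0n//.
by rewrite ler_nat ltnS ltnW.
Qed.

Lemma frac_coefN1 j : frac (- 1) j = 1.
Proof.
rewrite /frac_coef big1// => i _.
by rewrite opprK natr1 divff// pnatr_eq0.
Qed.

Lemma psum_frac h n : \sum_(j < n.+1) frac h j = frac (h - 1) n.
Proof.
rewrite -frac_coefD fpsM; apply: eq_bigr => j _.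
by rewrite frac_coefN1 mulr1.
Qed.

(** All coefficients after the leading 1 are nonpositive, while the partial sums are coefficients of
    (1 - z)^(h - 1) and hence nonnegative; so the absolute values after the first add up to at most
    1. *)
Lemma l1_frac_le2 h n : 0 <= h <= 1 -> l1 n (frac h) <= 2.
Proof.
move=> /andP[h0 h1]; apply: le_trans (le_l1 _ (leqnSn n)) _.
rewrite /l1 big_ord_recl/= frac_coef0 normr1.
have neg j : frac h j.+1 <= 0.
  elim: j => [|j IH]; first by rewrite /frac_coef big_ord1 sub0r divr1 oppr_le0.
  rewrite -(pmulr_lle0 _ (ltr0Sn R j.+1)) frac_coefS mulr_ge0_le0// subr_ge0.
  by apply: le_trans h1 _; rewrite ler1n.
have := psum_frac h n; rewrite big_ord_recl/= frac_coef0 => e.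
have : 0 <= frac (h - 1) n.
  by apply: prodr_ge0 => i _; rewrite divr_ge0// opprB addr_ge0// subr_ge0.
rewrite -e; under [X in _ -> 1 + X <= _]eq_bigr => i _ do rewrite ler0_norm//.
by rewrite sumrN; lra.
Qed.

Lemma frac_coefX h m : frac h ^+ m = frac (h *+ m).
Proof.
elim: m => [|m IH]; first by rewrite expr0 mulr0n frac_coef00.
by rewrite exprS IH frac_coefD mulrS.
Qed.

Lemma l1_frac_le h m n : 0 <= h <= m.+1%:R -> l1 n.+1 (frac h) <= 2 ^+ m.+1.
Proof.
move=> /andP[h0 hm].
have -> : frac h = frac (h / m.+1%:R) ^+ m.+1.
  by rewrite frac_coefX -(mulr_natr (h / _)) divfK// pnatr_eq0.
apply: le_trans (l1X _ _ _) _ => //.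
rewrite lerXn2r ?nnegrE ?l1_ge0// l1_frac_le2// divr_ge0//=.
by rewrite ler_pdivrMr ?ltr0n// mul1r.
Qed.

(** The coefficient is at least ((n + 1 + k) / (1 + k))^k. The shift by k inside the logarithms
    makes the induction step work: the increment of the left exponent and the logarithm of the ratio
    of coefficients are separated by k / (n + 1 + k). *)
Lemma frac_lower k n : 0 <= k ->
  expR (k * (ln (n.+1%:R + k) - ln (1 + k))) <= frac (- k - 1) n.
Proof.
move=> k0; elim: n => [|n IH]; first by rewrite subrr mulr0 expR0 frac_coef0.
have n0 m : 0 < m.+1%:R + k :> R by rewrite ltr_wpDr// ltr0n.
rewrite -(ler_pM2r (ltr0Sn R n)) frac_coefS.
have -> : n%:R - (- k - 1) = n.+1%:R + k by rewrite -natr1; ring.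
have -> : k * (ln (n.+2%:R + k) - ln (1 + k)) =
   k * (ln (n.+2%:R + k) - ln (n.+1%:R + k)) +
   k * (ln (n.+1%:R + k) - ln (1 + k)) by ring.
rewrite expRD mulrAC; apply: ler_pM; rewrite ?mulr_ge0 ?expR_ge0//.
rewrite -ler_pdivlMr ?ltr0n//.
have mk : 0 < (n.+1%:R + k) / n.+1%:R by rewrite divr_gt0 ?ltr0n.
rewrite -[leRHS](lnK mk) ler_expR.
apply: (@le_trans _ _ (k / (n.+1%:R + k))).
  rewrite ler_wpM2l// -ln_div ?posrE//.
  rewrite (_ : _ / _ = 1 + (n.+1%:R + k)^-1); last first.
    have -> : n.+2%:R + k = n.+1%:R + k + 1 by rewrite -[n.+2%:R]natr1 addrAC.
    by rewrite mulrDl divff ?gt_eqF// div1r.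
  by apply: le_ln1Dx; apply: (@lt_le_trans _ _ 0) => //; rewrite invr_ge0 ltW.
rewrite -[(n.+1%:R + k) / _]invrK lnV ?posrE ?invr_gt0// lerNr invf_div.
have -> : n.+1%:R / (n.+1%:R + k) = 1 + - (k / (n.+1%:R + k)).
  by rewrite -[X in X / _](addrK k) mulrBl divff ?gt_eqF.
apply: le_ln1Dx; rewrite ltrN2 ltr_pdivrMr// mul1r ltrDr ltr0n//.
Qed.

(** Cauchy-Schwarz bounds the energy below by the squared partial sum divided by its length, and the
    partial sum is the coefficient treated in [frac_lower]. The resulting order is n^(2k - 1). *)
Lemma sq_frac_lower k n : 0 <= k ->
  expR (2 * (k * (ln n.+1%:R - ln (1 + k)))) / n.+1%:R <= sq n.+1 (frac (- k)).
Proof.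
move=> k0; rewrite ler_pdivrMr ?ltr0n// [leRHS]mulrC.
apply: le_trans (psum_sqr_le _ _).
rewrite psum_frac expRM_natl lerXn2r ?nnegrE ?expR_ge0//.
  by apply: le_trans (frac_lower n k0); exact: expR_ge0.
apply: le_trans (frac_lower n k0).
by rewrite ler_expR ler_wpM2l// lerD2r ler_ln ?posrE ?ltr0n// ?ltr_wpDr ?ltr0n// lerDl.
Qed.

(** Squared coefficients are at most a constant times j^(2k - 1) / j. As 2k - 1 >= 0, the power is
    largest at the end, and the harmonic sum left over gives the logarithm, uniformly down to the
    critical k = 1/2. *)
Lemma sq_frac_upper k n : 2^-1 <= k ->
  sq n.+1 (frac (- k)) <=
  (1 + k ^+ 2 * expR (2 * k)) * expR ((2 * k - 1) * ln n.+1%:R) * (1 + ln n.+1%:R).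
Proof.
move=> k2; have k0 : 0 <= k by apply: le_trans k2; rewrite invr_ge0.
have l0 : 0 <= ln n.+1%:R :> R by rewrite ln_ge0// ler1n.
have e1 : 1 <= expR ((2 * k - 1) * ln n.+1%:R).
  by rewrite -[leLHS]expR0 ler_expR mulr_ge0//; lra.
rewrite /sq big_ord_recl frac_coef0 expr1n.
apply: (@le_trans _ _ (1 + k ^+ 2 * expR (2 * k) * expR ((2 * k - 1) * ln n.+1%:R) *
    \sum_(j < n) j.+1%:R^-1)); last first.
  have s0 : 0 <= \sum_(j < n) j.+1%:R^-1 :> R by apply: sumr_ge0 => j _; rewrite invr_ge0.
  have s1 : \sum_(j < n) j.+1%:R^-1 <= 1 + ln n.+1%:R :> R.
    by apply: le_trans (sum_inv_le n); rewrite big_ord_recr/= lerDl invr_ge0.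
  have c0 : 0 <= k ^+ 2 * expR (2 * k) by rewrite mulr_ge0 ?sqr_ge0 ?expR_ge0.
  set E := expR ((2 * k - 1) * _) in e1 *; set c := k ^+ 2 * _ in c0 *.
  set s := \sum_(j < n) _ in s0 s1 *; set l := 1 + ln _ in s1 *.
  have l1' : 1 <= l by rewrite /l lerDl.
  have : c * E * s <= c * E * l by rewrite ler_wpM2l// mulr_ge0//; lra.
  have : 1 <= E * l by rewrite -[leLHS]mulr1 ler_pM.
  lra.
rewrite lerD2l mulr_sumr; apply: ler_sum => j _; rewrite /= /bump/= add1n.
have b := frac_coef_bound (- k) j; rewrite normrN (ger0_norm k0) in b.
rewrite ler_pdivlMr ?ltr0n// -(ler_pM2r (ltr0Sn R j)) -[leLHS]mulrA -expr2 -exprMn.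
rewrite -real_normK ?num_real// normrM normr_nat.
apply: (@le_trans _ _ ((k * expR (k * (1 + ln j.+1%:R))) ^+ 2)).
  by rewrite lerXn2r ?nnegrE// mulr_ge0// expR_ge0.
rewrite exprMn -expRM_natl -[leRHS]mulrA -[leRHS]mulrA ler_wpM2l ?sqr_ge0//.
have ej : j.+1%:R = expR (ln j.+1%:R) :> R by rewrite lnK// posrE ltr0n.
rewrite [X in _ <= _ * (_ * X)]ej -!expRD ler_expR.
have lj : ln j.+1%:R <= ln n.+1%:R :> R.
  by rewrite ler_ln ?posrE ?ltr0n// ler_nat ltnS ltnW.
have : (2 * k - 1) * ln j.+1%:R <= (2 * k - 1) * ln n.+1%:R by rewrite ler_wpM2l//; lra.
lra.
Qed.

End Frac.

(** * Reciprocals of polynomials without zeros in the closed unit disk *)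

Lemma fps_inv_uniq (R : comNzRingType) (f g h : fps R) :
  f * g = 1 -> f * h = 1 -> g = h.
Proof. by move=> fg fh; rewrite -[g]mulr1 -fh mulrCA mulrA fg mul1r. Qed.

Section InvPoly.
Variable F : numFieldType.

Lemma inv_lin (c : F) : `|c| < 1 -> exists (g : fps F) (B : F),
  g * pser (1 - c *: 'X) = 1 /\ forall n, l1 n g <= B.
Proof.
move=> c1; exists (fun j => c ^+ j), (1 - `|c|)^-1; split.
  rewrite mulrC; apply/funext => n; rewrite fpsM fps1 big_ord_recl/= /pser.
  case: n => [|n].
    by rewrite big_ord0 addr0 coefB coef1 coefZ coefX mulr0 subr0 mul1r.
  rewrite big_ord_recl/= big1 ?addr0; last first.
    by move=> i _; rewrite coefB coef1 coefZ coefX /bump/= mulr0 subr0 mul0r.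
  rewrite !coefB !coef1 !coefZ !coefX /bump/= mulr0 subr0 mul1r subn0 mulr1 sub0r.
  by rewrite subSS subn0 exprS mulNr subrr.
move=> n; rewrite -[leRHS]div1r ler_pdivlMr ?subr_gt0//.
rewrite /l1; under eq_bigr do rewrite normrX.
have -> : (\sum_(i < n) `|c| ^+ i) * (1 - `|c|) = 1 - `|c| ^+ n.
  by rewrite -[RHS]opprB subrX1; ring.
by rewrite gerBl exprn_ge0.
Qed.

Lemma inv_prod_lin (s : seq F) : (forall c, c \in s -> `|c| < 1) ->
  exists (g : fps F) (B : F),
    g * pser (\prod_(c <- s) (1 - c *: 'X)) = 1 /\ forall n, l1 n g <= B.
Proof.
elim: s => [|c s IH] sc.
  by exists 1, 1; rewrite big_nil pser1 mulr1; split => // n; exact: l11.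
have [|g [B [gs gB]]] := IH; first by move=> d ds; apply: sc; rewrite inE ds orbT.
have [|h [D [hc hD]]] := @inv_lin c; first by apply: sc; rewrite inE eqxx.
exists (g * h), (B * D); split.
  rewrite big_cons pserM (_ : _ * _ = (g * pser (\prod_(j <- s) (1 - j *: 'X))) *
    (h * pser (1 - c *: 'X))); last by ring.
  by rewrite gs hc mulr1.
by move=> n; apply: le_trans (l1M _ _ _) _; rewrite ler_pM ?l1_ge0.
Qed.

End InvPoly.

Lemma prod_lin_of_roots (F : closedFieldType) (A : {poly F}) : A`_0 = 1 ->
  exists2 s : seq F, A = \prod_(c <- s) (1 - c *: 'X) &
    forall c, c \in s -> root A c^-1 /\ c != 0.
Proof.
move=> A0; have [r Ar] := closed_field_poly_normal A.
have Aneq0 : A != 0.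
  by apply/eqP => Az; move: A0; rewrite Az coef0 => /esym/eqP; rewrite oner_eq0.
have rr x : x \in r -> root A x.
  by move=> xr; rewrite Ar rootZ ?lead_coef_eq0// root_prod_XsubC.
have r0 x : x \in r -> x != 0.
  move=> /rr; apply: contraTneq => ->.
  by rewrite /root horner_coef0 A0 oner_eq0.
exists [seq x^-1 | x <- r]; last first.
  by move=> c /mapP[x xr ->]; rewrite invrK invr_eq0; split; [exact: rr|exact: r0].
have e : A = (lead_coef A * \prod_(x <- r) (- x)) *:
    \prod_(c <- [seq x^-1 | x <- r]) (1 - c *: 'X).
  rewrite {1}Ar -scalerA; congr (_ *: _); rewrite big_map.
  rewrite -[X in X *: _]mulr1 -mulr_algl alg_polyC mulr1 rmorph_prod/= -big_split/=.
  rewrite !big_seq; apply: eq_bigr => x /r0 x0.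
  by rewrite mulrBr mulr1 -mul_polyC mulrA -polyCM mulNr divff// !polyCN polyC1 mulN1r opprK addrC.
move: (_ * _ : F) e => k e; rewrite {1}e -[RHS]scale1r; congr (_ *: _).
have := A0; rewrite e coefZ -horner_coef0 horner_prod big1 ?mulr1//.
by move=> c _; rewrite !hornerE ?mulr0 ?subr0.
Qed.

(** Over the complex numbers [A] splits into factors 1 - cX with |c| < 1, inverted by geometric
    series; uniqueness of inverses identifies their product with the real series [inv_coef A]. *)
Lemma l1_inv_coef (R : realType) (A : {poly R}) : A`_0 = 1 ->
  (forall z : R[i], `|z| <= 1 -> ~~ croot A z) ->
  exists B : R, forall n, l1 n (inv_coef A : fps R) <= B.
Proof.
move=> A0 nr.
have AC0 : (map_poly (real_complex R) A)`_0 = 1 by rewrite coef_map A0.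
have [s As sr] := prod_lin_of_roots AC0.
have [|g [B [gA gB]]] := @inv_prod_lin _ s.
  move=> c /sr[rtc c0]; rewrite real_ltNge ?normr_real ?real1//; apply/negP => c1.
  by move: rtc; apply/negP/nr; rewrite normfV invf_le1// normr_gt0.
exists (complex.Re B) => n.
have gE : g = (fun j => real_complex R (inv_coef A j)).
  apply: (@fps_inv_uniq _ (pser (map_poly (real_complex R) A))); first by rewrite As mulrC.
  apply/funext => j; rewrite fpsM fps1.
  rewrite -(rmorph_nat (real_complex R)) -(inv_coefP j A0) rmorph_sum/=; apply: eq_bigr => i _.
  by rewrite /pser coef_map/= -rmorphM.
have : real_complex R (l1 n (inv_coef A : fps R)) <= B.
  apply: le_trans (gB n); rewrite rmorph_sum/= gE; apply: ler_sum => i _.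
  by rewrite normc_def/= expr0n addr0 sqrtr_sqr.
by rewrite lecE => /andP[_].
Qed.

(** * Uniformity over the parameter space *)

Section CompactUniform.
Variable R : realType.

(** Compactness in the form needed for constants: a property monotone in an integer and locally true
    holds globally for one integer. Bounds are therefore phrased with integers or their
    reciprocals. *)
Lemma compact_uniform m (K : set 'rV[R]_m) (P : nat -> 'rV[R]_m -> Prop) :
  compact K -> (forall i j y, (i <= j)%N -> P i y -> P j y) ->
  (forall x, K x -> exists2 r : R, 0 < r & exists i, forall y, K y ->
     (forall j, `|x 0 j - y 0 j| < r) -> P i y) ->
  exists i, forall y, K y -> P i y.
Proof.
move=> /compact_near_coveringP cK mono loc.
have [|i _ Pi] := cK nat \oo (fun i y => K y -> P i y) _ _.
  move=> x /loc[r r0 [i0 Hi]].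
  exists (ball x r, [set i | (i0 <= i)%N]).
    by split; [exact: (nbhsx_ballx x r r0) | exact: nbhs_infty_ge].
  move=> [y i] [/= [_ xy] i0i] Ky; apply: mono i0i _; apply: Hi => // j.
  exact: (xy 0 j).
by exists i => y Ky; exact: (Pi i (leqnn i) y Ky Ky).
Qed.

Lemma param_space_compact p1 p2 (Pi : set 'rV[R]_(p1 + p2)) (L U : R) :
  compact Pi -> compact (param_space Pi L U).
Proof.
move=> cPi.
pose f (z : 'rV[R]_(p1 + p2) * R) : 'rV[R]_(p1 + p2 + 1) :=
  row_mx z.1 (const_mx z.2).
have -> : param_space Pi L U = f @` (Pi `*` `[L, U]).
  apply/seteqP; split => [eta [Pe de]|_ [[t d] [/= Pt dLU] <-]].
    exists (theta_of eta, d_of eta); first by split => //=; rewrite in_itv.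
    rewrite /f/= -[RHS]hsubmxK; congr row_mx; apply/matrixP => i j.
    by rewrite !ord1 mxE.
  split; first by rewrite /f/= /theta_of row_mxKl.
  by move: dLU; rewrite /f/= /d_of row_mxKr mxE in_itv.
apply: continuous_compact; last first.
  by apply: compact_setX => //; exact: segment_compact.
apply: continuous_subspaceT => -[t d].
apply/cvg_ballP => e e0.
exists (ball t e, ball d e); first by split; [exact: (nbhsx_ballx t e e0)|exact: (nbhsx_ballx d e e0)].
move=> [t' d'] /= [tb dd']; have tt' i j : ball (t i j) e (t' i j) := tb.2 i j.
apply: (conj e0) => i j.
rewrite /f/= !mxE; case: (fintype.split j) => k; first by rewrite ord1; exact: tt'.
by rewrite !mxE.
Qed.

End CompactUniform.

(** * Lag polynomials and their dependence on the coefficients *)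

Section LagPoly.
Variable R : realType.
Variable p : nat.
Implicit Types a b : 'I_p -> R.

(** Both [ar_poly] and [ma_poly] are instances by conversion, so one proof serves the two blocks. *)
Definition lag_poly a : {poly R} := 1 - \sum_(j < p) a j *: 'X^(j.+1).

Lemma lag_poly0 a : (lag_poly a)`_0 = 1.
Proof.
rewrite coefB coef1 coef_sum big1 ?subr0// => j _.
by rewrite coefZ coefXn mulr0.
Qed.

Lemma lag_polyS a (j : 'I_p) : (lag_poly a)`_j.+1 = - a j.
Proof.
rewrite coefB coef1 coef_sum (bigD1 j)//= coefZ coefXn eqxx mulr1 sub0r.
rewrite big1 ?addr0// => i ij; rewrite coefZ coefXn eqSS.
by rewrite eq_sym (negbTE (ij : (i : nat) != j)) mulr0.
Qed.

Lemma l1_monom n (c : R) k : l1 n (pser (c *: 'X^k)) <= `|c|.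
Proof.
apply: (@le_trans _ _ (\sum_(i < n) `|c| * (i == k :> nat)%:R)).
  by apply: ler_sum => i _; rewrite /pser coefZ coefXn normrM normr_nat.
rewrite -mulr_sumr ler_piMr//.
case: (ltnP k n) => kn.
  rewrite (bigD1 (Ordinal kn))//= eqxx big1 ?addr0// => i ik.
  by rewrite (negbTE (ik : (i : nat) != k)).
rewrite big1 ?ler01// => i _; case: eqP => // ik.
by move: (ltn_ord i); rewrite ik ltnNge kn.
Qed.

Lemma l1_lag_lip n (r : R) a b : (forall j, `|a j - b j| <= r) ->
  l1 n (pser (lag_poly a) - pser (lag_poly b)) <= p%:R * r.
Proof.
move=> abr.
have -> : pser (lag_poly a) - pser (lag_poly b) =
    \sum_(j < p) pser ((b j - a j) *: 'X^(j.+1)).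
  apply/funext => i; rewrite fpsB /pser !coefB opprB addrC addrA subrK.
  rewrite !coef_sum -sumrB.
  transitivity ((\sum_(j < p) (b j - a j) *: 'X^(j.+1))`_i).
    rewrite coef_sum; apply: eq_bigr => j _.
    by rewrite !coefZ mulrBl.
  rewrite coef_sum; elim/big_ind2 : _ => //= f x g y -> ->; exact: fpsD.
apply: (@le_trans _ _ (\sum_(j < p) l1 n (pser ((b j - a j) *: 'X^(j.+1))))).
  elim/big_ind2 : _ => [|x1 x2 y1 y2 h1 h2|//].
    by rewrite /l1 big1// => i _; rewrite normr0.
  by apply: le_trans (l1D _ _ _) _; exact: lerD.
apply: (@le_trans _ _ (\sum_(j < p) r)).
  by apply: ler_sum => j _; apply: le_trans (l1_monom _ _ _) _; rewrite distrC.
by rewrite sumr_const card_ord mulr_natl.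
Qed.

Lemma l1_lag_le n a (r : R) : (forall j, `|a j| <= r) ->
  l1 n (pser (lag_poly a)) <= 1 + p%:R * r.
Proof.
move=> ar; have e1 : lag_poly (fun=> 0) = 1.
  by rewrite /lag_poly big1 ?subr0// => i _; rewrite scale0r.
rewrite -[pser _](subrK (pser (lag_poly (fun=> 0)))) addrC.
apply: le_trans (l1D _ _ _) _; rewrite e1 pser1; apply: lerD; first exact: l11.
by rewrite -pser1 -e1; apply: l1_lag_lip => j; rewrite subr0.
Qed.

End LagPoly.

(* Neumann series. *)
Lemma l1_inv_perturb (R : realType) (A A' : {poly R}) (B r : R) :
  A`_0 = 1 -> A'`_0 = 1 ->
  (forall n, l1 n (inv_coef A : fps R) <= B) ->
  (forall n, l1 n (pser A - pser A') <= r) -> r * B <= 2^-1 ->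
  forall n, l1 n (inv_coef A' : fps R) <= 2 * B.
Proof.
move=> A0 A'0 hB hr rB n.
set g : fps R := inv_coef A; set g' : fps R := inv_coef A'.
have gA : pser A * g = 1 := pser_inv_coef A0.
have gA' : pser A' * g' = 1 := pser_inv_coef A'0.
have e : g' = g + g' * ((pser A - pser A') * g).
  transitivity (g + g' * (pser A * g) - (pser A' * g') * g); last by ring.
  by rewrite gA gA'; ring.
have : l1 n g' <= B + l1 n g' * 2^-1.
  rewrite {1}e; apply: le_trans (l1D _ _ _) _; apply: lerD; first exact: hB.
  apply: le_trans (l1M _ _ _) _; rewrite ler_wpM2l ?l1_ge0//.
  apply: le_trans (l1M _ _ _) _; apply: le_trans rB.
  by apply: ler_pM; rewrite ?l1_ge0//; exact: hB.
lra.
Qed.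

Lemma frac_l1_unbounded (R : realType) (h B : R) : 0 < h ->
  ~ (forall n, l1 n (frac_coef (- h) : fps R) <= B).
Proof.
move=> h0 hB.
(* This solves h (ln x - ln (1 + h)) = B, so the partial sum up to [n] is at least e^B >= 1 + B. *)
pose x := expR (ln (1 + h) + B / h); pose n := Num.truncn x.
have xn : x < n.+1%:R by rewrite /n truncnS_gt// expR_ge0.
have : expR B <= B.
  apply: le_trans (hB n.+1); apply: (@le_trans _ _ (\sum_(j < n.+1) frac_coef (- h) j)).
    rewrite psum_frac; apply: le_trans (frac_lower n (ltW h0)); rewrite ler_expR.
    rewrite -ler_pdivrMl// mulrC lerBrDl.
    apply: (@le_trans _ _ (ln n.+1%:R)); last first.
      by rewrite ler_ln ?posrE ?ltr0n ?ltr_wpDr ?ltr0n ?lerDl// ltW.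
    by rewrite -[leLHS]expRK ler_ln ?posrE ?expR_gt0 ?ltr0n// ltW.
  by apply: ler_sum => j _; exact: ler_norm.
by apply/negP; rewrite -ltNge; have := expR_ge1Dx B; lra.
Qed.

Section UniformBounds.
Variables (R : realType) (m p : nat) (K : set 'rV[R]_m) (sel : 'I_p -> 'I_m).
Hypothesis cK : compact K.
Let A (theta : 'rV[R]_m) := lag_poly (fun j => theta 0 (sel j)).

Lemma compact_coord_bounded :
  exists i : nat, forall theta, K theta -> forall j, `|theta 0 j| <= i%:R.
Proof.
apply: (compact_uniform cK (P := fun i theta => forall j, `|theta 0 j| <= i%:R)).
  by move=> i j y ij yi k; apply: le_trans (yi k) _; rewrite ler_nat.
move=> x Kx; exists 1 => //.
pose B := \sum_j `|x 0 j| + 1; exists (Num.truncn B).+1 => y Ky xy j.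
apply: (@le_trans _ _ B); last by rewrite ltW// truncnS_gt.
rewrite -[y 0 j](subrK (x 0 j)) addrC.
apply: le_trans (ler_normD _ _) _; apply: lerD; last by rewrite distrC ltW.
by rewrite (bigD1 j)//= lerDl sumr_ge0.
Qed.

Lemma l1_lag_uniform :
  exists i : nat, forall theta, K theta -> forall n, l1 n (pser (A theta)) <= i%:R.
Proof.
have [i iK] := compact_coord_bounded.
exists (1 + p * i)%N => t Kt n; rewrite natrD natrM.
by apply: l1_lag_le => j; exact: iK.
Qed.

Lemma l1_lag_inv_uniform :
  (forall theta, K theta -> forall z : R[i], `|z| <= 1 -> ~~ croot (A theta) z) ->
  exists i : nat, forall theta, K theta ->
    forall n, l1 n (inv_coef (A theta) : fps R) <= i%:R.
Proof.
move=> Kroot.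
apply: (compact_uniform cK (P := fun i theta =>
  forall n, l1 n (inv_coef (A theta) : fps R) <= i%:R)).
  by move=> i j y ij yi n; apply: le_trans (yi n) _; rewrite ler_nat.
move=> x Kx; have [B0 hB0] := l1_inv_coef (lag_poly0 _) (Kroot _ Kx).
pose B := Num.max B0 1.
have hB n : l1 n (inv_coef (A x) : fps R) <= B.
  by apply: le_trans (hB0 n) _; rewrite le_max lexx.
have B0' : 0 < B by rewrite lt_max ltr01 orbT.
(* Within this radius the polynomial moves by at most 1 / (2B) in l^1, as [l1_inv_perturb] requires;
   p + 1 in place of p keeps the radius positive for an empty block. *)
exists (2 * p.+1%:R * B)^-1; first by rewrite invr_gt0 !mulr_gt0// ltr0n.
exists (Num.truncn (2 * B)).+1 => y Ky xy n.
apply: (@le_trans _ _ (2 * B)); last by rewrite ltW// truncnS_gt.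
apply: (l1_inv_perturb (lag_poly0 _) (lag_poly0 _) hB
  (r := p%:R * (2 * p.+1%:R * B)^-1)).
  by move=> k; apply: l1_lag_lip => j; exact: ltW.
have -> : p%:R * (2 * p.+1%:R * B)^-1 * B = 2^-1 * (p%:R / p.+1%:R).
  have q0 : p.+1%:R != 0 :> R by rewrite pnatr_eq0.
  move: (p.+1%:R : R) q0 => q q0; field.
  by rewrite q0 gt_eqF.
rewrite ler_piMr ?invr_ge0//.
by rewrite ler_pdivrMr ?ltr0n// mul1r ler_nat.
Qed.

End UniformBounds.

(** * The residual filter and its identifiability *)

Section Transfer.
Variables (R : realType) (p1 p2 : nat).
Implicit Types (theta : 'rV[R]_(p1 + p2)) (eta : 'rV[R]_(p1 + p2 + 1)).

Lemma ar_poly0 theta : (ar_poly theta)`_0 = 1.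
Proof. exact: lag_poly0. Qed.

Lemma ma_poly0 theta : (ma_poly theta)`_0 = 1.
Proof. exact: lag_poly0. Qed.

Let ar theta : fps R := pser (ar_poly theta).
Let ma theta : fps R := pser (ma_poly theta).
Let iar theta : fps R := inv_coef (ar_poly theta).
Let ima theta : fps R := inv_coef (ma_poly theta).
Let frac d : fps R := frac_coef d.

(* The short-memory part of the filter that maps (eps_t) to (eps_t(eta)). *)
Definition short_filter theta0 theta : fps R :=
  pser (ar_poly theta) * (inv_coef (ma_poly theta) : fps R) *
  (pser (ma_poly theta0) * (inv_coef (ar_poly theta0) : fps R)).

Definition resid_filter eta0 eta : fps R :=
  short_filter (theta_of eta0) (theta_of eta) *
  (frac_coef (d_of eta - d_of eta0) : fps R).

Let arK theta : ar theta * iar theta = 1. Proof. exact: pser_inv_coef (ar_poly0 _). Qed.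
Let maK theta : ma theta * ima theta = 1. Proof. exact: pser_inv_coef (ma_poly0 _). Qed.

Lemma short_filterV theta0 theta : short_filter theta0 theta * short_filter theta theta0 = 1.
Proof.
rewrite /short_filter -/(ar theta) -/(ima theta) -/(ma theta0) -/(iar theta0).
rewrite -/(ar theta0) -/(ima theta0) -/(ma theta) -/(iar theta).
transitivity ((ar theta * iar theta) * (ma theta * ima theta) *
  ((ar theta0 * iar theta0) * (ma theta0 * ima theta0))); first by ring.
by rewrite !arK !maK !mulr1.
Qed.

Lemma short_filter_id theta : short_filter theta theta = 1.
Proof.
transitivity ((ar theta * iar theta) * (ma theta * ima theta)).
  by rewrite /short_filter/ar/ma/iar/ima; ring.
by rewrite arK maK mulr1.
Qed.

Lemma resid_filter_id eta : resid_filter eta eta = 1.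
Proof. by rewrite /resid_filter short_filter_id subrr frac_coef00 mulr1. Qed.

Lemma resid_filter0 eta0 eta : resid_filter eta0 eta 0 = 1.
Proof.
have inv0 (A : {poly R}) : inv_coef A 0 = 1.
  by rewrite /inv_coef big_ord1 expr0 coef1.
by rewrite /resid_filter /short_filter !fpsM0 !inv0 frac_coef0 /pser ar_poly0 ma_poly0 !mulr1.
Qed.

Lemma residual_filterE eta0 eta (y e : nat -> R) : arfima eta0 y e ->
  fshift (residual eta y) = resid_filter eta0 eta * fshift e.
Proof.
move=> m; rewrite /residual !fshift_filt.
set t := theta_of eta; set t0 := theta_of eta0.
set d := d_of eta; set d0 := d_of eta0.
have E : ar t0 * (frac d0 * fshift y) = ma t0 * fshift e.
  apply/funext => n; have := m n.+1 isT.
  by rewrite !filtE fshift_filt.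
transitivity (ar t * ima t * frac (d - d0) *
  (iar t0 * (ar t0 * (frac d0 * fshift y)))).
  rewrite -[d in LHS](subrK d0) -frac_coefD.
  rewrite -/(frac _) -/(frac d0) -/(ima t) -/(ar t).
  transitivity (ar t * ima t * frac (d - d0) * (frac d0 * fshift y) *
    (ar t0 * iar t0)); last by ring.
  rewrite arK.
  change (ar t * (ima t * (frac (d - d0) * frac d0 * fshift y)) =
    ar t * ima t * frac (d - d0) * (frac d0 * fshift y) * 1).
  by ring.
rewrite E /resid_filter /short_filter -/(ar t) -/(ima t) -/(ma t0) -/(iar t0) -/(frac (d - d0)).
by ring.
Qed.

Lemma residual_sq eta0 eta (y e : nat -> R) n : arfima eta0 y e ->
  \sum_(1 <= t < n.+1) (residual eta y t - residual eta0 y t) ^+ 2 =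
  sq n ((resid_filter eta0 eta - 1) * fshift e).
Proof.
move=> m; rewrite big_add1/= big_mkord; apply: eq_bigr => t _.
have e1 := congr1 (@^~ (t : nat)) (residual_filterE eta m).
have e0 := congr1 (@^~ (t : nat)) (residual_filterE eta0 m).
rewrite /= /fshift in e1 e0; rewrite e1 e0.
by rewrite resid_filter_id -fpsB -mulrBl.
Qed.

Lemma admissible_coprime theta : admissible theta ->
  coprimep (ar_poly theta) (ma_poly theta).
Proof.
case=> _ _ nc _; rewrite -(coprimep_map (real_complex R)).
apply: Pdiv.ClosedField.root_coprimep => z rz.
by apply/negP => rz'; apply: (nc z); split.
Qed.

(** Identifiability. A trivial filter forces the short-memory part to be (1 - z)^(-h) and its
    inverse (1 - z)^h; the bound [S] excludes h > 0 and [S'] excludes h < 0. What remains is a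
    polynomial identity, in which coprimality makes the two autoregressive polynomials divide each
    other. *)
Lemma resid_filter_inj eta0 eta (S S' : R) :
  admissible (theta_of eta0) -> admissible (theta_of eta) ->
  (forall n, l1 n (short_filter (theta_of eta0) (theta_of eta)) <= S) ->
  (forall n, l1 n (short_filter (theta_of eta) (theta_of eta0)) <= S') ->
  resid_filter eta0 eta = 1 -> eta = eta0.
Proof.
move=> adm0 adm hS hS' b1.
set t := theta_of eta in adm hS hS' b1 *; set t0 := theta_of eta0 in adm0 hS hS' b1 *.
set h := d_of eta - d_of eta0.
have wf : short_filter t0 t * frac h = 1 by [].
have fV : frac h * frac (- h) = 1 by rewrite /frac frac_coefD subrr frac_coef00.
have wE : short_filter t0 t = frac (- h).
  by apply: (fps_inv_uniq (f := frac h)) => //; rewrite mulrC.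
have wE' : short_filter t t0 = frac h.
  by apply: (fps_inv_uniq (f := short_filter t0 t)) => //; exact: short_filterV.
have h0 : h = 0.
  have [hlt|hgt|//] := ltgtP h 0.
    exfalso; apply: (@frac_l1_unbounded R (- h) S'); first by rewrite oppr_gt0.
    by move=> n; rewrite opprK -/(frac h) -wE'.
  exfalso; apply: (@frac_l1_unbounded R h S) => // n.
  by rewrite -/(frac (- h)) -wE.
have dE : d_of eta = d_of eta0 by apply/eqP; rewrite -subr_eq0 -/h h0.
have w1 : short_filter t0 t = 1 by rewrite wE h0 oppr0 /frac frac_coef00.
have pE : ar_poly t * ma_poly t0 = ma_poly t * ar_poly t0.
  apply: pser_inj; rewrite !pserM -/(ar t) -/(ma t0) -/(ma t) -/(ar t0).
  transitivity (ar t * ma t0 * (ma t * ima t) * (ar t0 * iar t0)).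
    by rewrite arK maK !mulr1.
  transitivity (short_filter t0 t * (ma t * ar t0)); last by rewrite w1 mul1r.
  by rewrite /short_filter -/(ar t) -/(ima t) -/(ma t0) -/(iar t0); ring.
have dv1 : ar_poly t %| ar_poly t0.
  by rewrite -(Gauss_dvdpr _ (admissible_coprime adm)) -pE dvdp_mulr.
have dv2 : ar_poly t0 %| ar_poly t.
  by rewrite -(Gauss_dvdpl _ (admissible_coprime adm0)) pE dvdp_mull.
have arE : ar_poly t = ar_poly t0.
  have /eqpP[[c1 c2]/= /andP[c10 c20] cE] : ar_poly t %= ar_poly t0.
    by rewrite /eqp dv1.
  have := congr1 (fun p : {poly R} => p`_0) cE.
  rewrite !coefZ !ar_poly0 !mulr1 => c12.
  by move: cE; rewrite c12 => /(scalerI c20).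
have maE : ma_poly t = ma_poly t0.
  move: pE; rewrite arE mulrC => /mulIf -> //.
  by apply/eqP => /(congr1 (fun p : {poly R} => p`_0)) /eqP; rewrite ar_poly0 coef0 oner_eq0.
have tE : t = t0.
  rewrite -[t]hsubmxK -[t0]hsubmxK; congr row_mx; apply/rowP => j; rewrite !mxE.
    have := congr1 (fun p : {poly R} => p`_j.+1) arE.
    by rewrite !lag_polyS => /oppr_inj; rewrite !mxE.
  have := congr1 (fun p : {poly R} => p`_j.+1) maE.
  by rewrite !lag_polyS => /oppr_inj; rewrite !mxE.
rewrite -[eta]hsubmxK -[eta0]hsubmxK; congr row_mx; first exact: tE.
by apply/matrixP => i j; rewrite !ord1; exact: dE.
Qed.

End Transfer.

(** * Continuity and energy of the residual filter *)

Section Deterministic.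
Variables (R : realType) (p1 p2 : nat).
Implicit Types (theta : 'rV[R]_(p1 + p2)) (eta : 'rV[R]_(p1 + p2 + 1)).
Variables (Pi : set 'rV[R]_(p1 + p2)) (L U : R) (eta0 : 'rV[R]_(p1 + p2 + 1)).
Hypothesis Pi_compact : compact Pi.
Hypothesis Pi_adm : forall theta, Pi theta -> admissible theta.
Hypothesis eta0_in : param_space Pi L U eta0.
Local Notation PD := (param_space Pi L U).
Local Notation frac h := (frac_coef h : fps R).
Local Notation ell n := (1 + ln n.+1%:R : R).

Lemma ell_ge1 n : 1 <= ell n.
Proof. by rewrite lerDl ln_ge0// ler1n. Qed.

Lemma short_memory_bound : exists2 S : R, 1 <= S &
  forall theta, Pi theta -> forall n,
  [/\ l1 n (pser (ar_poly theta)) <= S, l1 n (pser (ma_poly theta)) <= S,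
      l1 n (inv_coef (ar_poly theta) : fps R) <= S &
      l1 n (inv_coef (ma_poly theta) : fps R) <= S].
Proof.
have [i1 h1] := l1_lag_uniform (lshift p2) Pi_compact.
have [i2 h2] := l1_lag_uniform (@rshift p1 p2) Pi_compact.
have [|i3 h3] := @l1_lag_inv_uniform R _ _ Pi (lshift p2) Pi_compact.
  by move=> t /Pi_adm[].
have [|i4 h4] := @l1_lag_inv_uniform R _ _ Pi (@rshift p1 p2) Pi_compact.
  by move=> t /Pi_adm[].
exists (i1 + i2 + i3 + i4).+1%:R; first by rewrite ler1n.
move=> t Pt n; split.
- by apply: le_trans (h1 _ Pt n) _; rewrite ler_nat; lia.
- by apply: le_trans (h2 _ Pt n) _; rewrite ler_nat; lia.
- by apply: le_trans (h3 _ Pt n) _; rewrite ler_nat; lia.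
- by apply: le_trans (h4 _ Pt n) _; rewrite ler_nat; lia.
Qed.

Lemma l1M_le n (f g : fps R) (a b : R) : l1 n f <= a -> l1 n g <= b ->
  l1 n (f * g) <= a * b.
Proof. by move=> fa gb; apply: le_trans (l1M _ _ _) _; rewrite ler_pM ?l1_ge0. Qed.

Lemma short_filter_bound : exists2 S : R, 1 <= S & forall theta theta',
  Pi theta -> Pi theta' -> forall n, l1 n (short_filter theta theta') <= S.
Proof.
have [S S1 hS] := short_memory_bound; exists (S * S * (S * S)).
  by rewrite -[leLHS]mulr1 ler_pM ?ler01// -[leLHS]mulr1 ler_pM.
move=> t t' Pt Pt' n; have [? ? ? ?] := hS _ Pt n; have [? ? ? ?] := hS _ Pt' n.
by do 2?apply: l1M_le.
Qed.

Lemma short_filter_lip : exists2 C : R, 0 <= C & forall theta0 theta theta' r,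
  Pi theta0 -> Pi theta -> Pi theta' ->
  (forall i, `|theta 0 i - theta' 0 i| <= r) ->
  forall n, l1 n (short_filter theta0 theta - short_filter theta0 theta') <= C * r.
Proof.
have [S S1 hS] := short_memory_bound.
have S0 : 0 <= S by apply: le_trans S1.
exists ((p1%:R * S + S * (S * S * p2%:R)) * (S * S)).
  by rewrite !(mulr_ge0, addr_ge0).
move=> t0 t t' r Pt0 Pt Pt' tt' n.
have [a0 m0 ia0 im0] := hS _ Pt0 n; have [a m ia im] := hS _ Pt n.
have [a' m' ia' im'] := hS _ Pt' n.
have da : l1 n (pser (ar_poly t) - pser (ar_poly t')) <= p1%:R * r.
  by apply: l1_lag_lip => j; exact: tt'.
have dm : l1 n (pser (ma_poly t') - pser (ma_poly t)) <= p2%:R * r.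
  by apply: l1_lag_lip => j; rewrite distrC; exact: tt'.
have mK := pser_inv_coef (ma_poly0 t); have mK' := pser_inv_coef (ma_poly0 t').
rewrite /short_filter.
move: (pser (ar_poly t)) (pser (ar_poly t')) (pser (ma_poly t)) (pser (ma_poly t'))
  (inv_coef (ma_poly t) : fps R) (inv_coef (ma_poly t') : fps R) mK mK' a a' m m' im im' da dm.
move=> A A' M M' I I' mK mK' a a' m m' im im' da dm.
move: (pser (ma_poly t0)) (inv_coef (ar_poly t0) : fps R) m0 ia0 => M0 I0 m0 ia0.
(* The inverses satisfy I - I' = I I' (M' - M), so Lipschitz dependence passes from the polynomials
   to their reciprocals. *)
have -> : A * I * (M0 * I0) - A' * I' * (M0 * I0) =
   ((A - A') * I + A' * (I * I' * (M' - M))) * (M0 * I0).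
  transitivity (((A - A') * I + A' * (I * (M' * I') - I' * (M * I))) * (M0 * I0)).
    by rewrite mK mK'; ring.
  by ring.
have -> : (p1%:R * S + S * (S * S * p2%:R)) * (S * S) * r =
  (p1%:R * r * S + S * (S * S * (p2%:R * r))) * (S * S) by ring.
apply: l1M_le; last exact: l1M_le.
apply: le_trans (l1D _ _ _) _; apply: lerD; first exact: l1M_le.
by apply: l1M_le => //; apply: l1M_le => //; exact: l1M_le.
Qed.

(* The difference of two filters factors through the long-memory part of the
   second one, so no power of [n] is lost. *)
Lemma resid_filter_lip : exists2 C : R, 0 <= C & forall eta eta' r n,
  PD eta -> PD eta' -> (forall i, `|eta 0 i - eta' 0 i| <= r) ->
  r * ell n <= 1 ->
  exists2 D : fps R,
    resid_filter eta0 eta - resid_filter eta0 eta' = D * frac (d_of eta' - d_of eta0) &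
    l1 n.+1 D <= C * (r * ell n).
Proof.
have [S S1 hS] := short_filter_bound; have [C C0 hC] := short_filter_lip.
have S0 : 0 <= S by apply: le_trans S1.
(* It bounds the exponential factor in [l1_frac_sub1], whose exponent is at most r (1 + ln (n + 1))
   <= 1. *)
pose e := expR 1 : R; have e0 : 0 <= e by exact: expR_ge0.
exists (C * (1 + e) + S * e); first by rewrite addr_ge0 ?mulr_ge0 ?addr_ge0.
move=> eta eta' r n [Pe _] [Pe' _] ee' rl.
have [P0 _] := eta0_in.
set h := d_of eta - d_of eta'.
have hr : `|h| <= r by rewrite /h /d_of !mxE; exact: ee'.
have r0 : 0 <= r by apply: le_trans hr.
have ell1 := ell_ge1 n.
have rl0 : 0 <= r * ell n by rewrite mulr_ge0//; lra.
have rle : r <= r * ell n by rewrite ler_peMr.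
have lh : l1 n.+1 (frac h - 1) <= r * ell n * e.
  apply: le_trans (l1_frac_sub1 _ _) _.
  rewrite mulrAC; apply: ler_pM; rewrite ?expR_ge0 ?mulr_ge0//; first lra.
    by rewrite ler_wpM2r//; lra.
  by rewrite ler_expR; apply: le_trans rl; rewrite ler_wpM2r//; lra.
have lh1 : l1 n.+1 (frac h) <= 1 + e.
  rewrite (_ : frac h = 1 + (frac h - 1)); last by ring.
  apply: le_trans (l1D _ _ _) _.
  apply: lerD; first exact: l11.
  by apply: le_trans lh _; rewrite ler_piMl.
set W := short_filter (theta_of eta0) (theta_of eta).
set W' := short_filter (theta_of eta0) (theta_of eta').
exists ((W - W') * frac h + W' * (frac h - 1)).
  rewrite /resid_filter -/W -/W'.
  have -> : d_of eta - d_of eta0 = h + (d_of eta' - d_of eta0) by rewrite /h; ring.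
  by rewrite -frac_coefD; ring.
apply: le_trans (l1D _ _ _) _; rewrite [leRHS]mulrDl; apply: lerD.
  rewrite [leRHS]mulrAC; apply: l1M_le => //.
  apply: (@le_trans _ _ (C * r)); last by rewrite ler_wpM2l.
  by apply: hC => // i; have := ee' (lshift 1 i); rewrite !mxE.
by rewrite -mulrA [e * _]mulrC; apply: l1M_le => //; exact: hS.
Qed.

Lemma enorm_lt_of_coord m (v : 'rV[R]_m) (delta : R) : 0 < delta ->
  (forall i, `|v 0 i| < delta / m.+1%:R) -> enorm v < delta.
Proof.
move=> d0 hv; rewrite /enorm.
rewrite -[ltRHS](@ger0_norm _ delta) ?ltW// -sqrtr_sqr ltr_sqrt ?exprn_gt0//.
have m0 : 0 < m.+1%:R :> R by rewrite ltr0n.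
have r0 : 0 < delta / m.+1%:R by rewrite divr_gt0.
apply: (@le_lt_trans _ _ (\sum_(i < m) (delta / m.+1%:R) ^+ 2)).
  apply: ler_sum => i _; rewrite -real_normK ?num_real//.
  by rewrite lerXn2r ?nnegrE ?(ltW r0)// ltW.
rewrite sumr_const card_ord -[_ *+ m]mulr_natl.
apply: (@lt_le_trans _ _ (m.+1%:R * (delta / m.+1%:R) ^+ 2)).
  by rewrite ltr_pM2r ?exprn_gt0// ltr_nat.
apply: (@le_trans _ _ (m.+1%:R ^+ 2 * (delta / m.+1%:R) ^+ 2)).
  by rewrite ler_pM2r ?exprn_gt0// expr2 ler_peMr// ?ler1n// ltW.
by rewrite -exprMn mulrC divfK// gt_eqF.
Qed.

Lemma sq_resid_filter_sub1 eta n :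
  sq n.+1 (resid_filter eta0 eta) = 1 + sq n.+1 (resid_filter eta0 eta - 1).
Proof.
rewrite /sq !big_ord_recl/= fpsB resid_filter0 fps1 subrr expr0n/= add0r expr1n.
by congr (_ + _); apply: eq_bigr => i _; rewrite fpsB fps1 subr0.
Qed.

(** Away from [eta0], identifiability gives a nonzero coefficient, which stays away from 0 nearby by
    [resid_filter_lip]. Around [eta0] the claim is vacuous, so compactness can be used on the whole
    parameter space. *)
Lemma resid_filter_separated (delta : R) : 0 < delta ->
  exists i : nat, forall eta, (PD `\` eball eta0 delta) eta ->
    i.+1%:R^-1 <= sq i.+1 (resid_filter eta0 eta - 1).
Proof.
move=> delta0; have cPD := @param_space_compact R p1 p2 Pi L U Pi_compact.
have [C C0 hC] := resid_filter_lip; have [S S1 hS] := short_filter_bound.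
have [||i hi] := @compact_uniform R _ PD (fun i eta => ~ eball eta0 delta eta ->
    i.+1%:R^-1 <= sq i.+1 (resid_filter eta0 eta - 1)) cPD; last first.
- by exists i => eta [Pe Ne]; exact: hi.
- move=> x Px; have [xe|/eqP xne] := pselect (x = eta0).
    exists (delta / (p1 + p2 + 1).+1%:R); first by rewrite divr_gt0 ?ltr0n.
    exists 0%N => y _ xy []; apply: enorm_lt_of_coord => // j.
    by rewrite !mxE distrC -xe; exact: xy.
  have [s bs] : exists s, (resid_filter eta0 x - 1) s != 0.
    apply: contrapT => nex; move/eqP: xne; apply.
    apply: (@resid_filter_inj _ _ _ _ _ S S).
    + by apply: Pi_adm; case: eta0_in.
    + by apply: Pi_adm; case: Px.
    + by apply: hS; [case: eta0_in|case: Px].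
    + by apply: hS; [case: Px|case: eta0_in].
    apply/eqP; rewrite -subr_eq0; apply/eqP/funext => s; apply: contrapT => bs.
    by apply: nex; exists s; apply/eqP.
  set a := `|(resid_filter eta0 x - 1) s|.
  have a0 : 0 < a by rewrite normr_gt0.
  set Q := C * ell s * l1 s.+1 (frac (d_of x - d_of eta0)).
  have l0 := ell_ge1 s.
  have l0' : 0 < ell s by apply: lt_le_trans l0.
  have Q0 : 0 <= Q by rewrite !mulr_ge0 ?l1_ge0// ltW.
  (* The first entry makes [resid_filter_lip] applicable at length s + 1; the second keeps the
     change of coefficient [s] below a / 2. *)
  exists (Num.min (ell s)^-1 (a / 2 / (Q + 1))).
    by rewrite lt_min invr_gt0 l0' !divr_gt0// ltr_wpDl.
  set r := Num.min _ _.
  (* Large enough to include coefficient [s] in the energy and to have a reciprocal below (a /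
     2)^2. *)
  exists (s + Num.truncn (4 / a ^+ 2)).+1 => y Py xy _.
  have [||D bD lD] := hC y x r s Py Px.
  + by move=> j; rewrite distrC ltW.
  + by rewrite -ler_pdivlMr// div1r /r ge_min lexx.
  have db : `|(resid_filter eta0 y - resid_filter eta0 x) s| <= a / 2.
    apply: le_trans (ler_coef_l1 _ (ltnSn s)) _.
    rewrite bD; apply: le_trans (l1M _ _ _) _.
    apply: (@le_trans _ _ (r * Q)).
      rewrite (_ : r * Q = C * (r * ell s) * l1 s.+1 (frac (d_of x - d_of eta0))).
        by rewrite ler_wpM2r ?l1_ge0.
      by rewrite /Q; ring.
    apply: (@le_trans _ _ (a / 2 / (Q + 1) * Q)).
      by rewrite ler_wpM2r// /r ge_min lexx orbT.
    rewrite -mulrA ler_piMr ?divr_ge0 ?(ltW a0)//.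
    by rewrite mulrC ler_pdivrMr ?mul1r ?lerDl// ltr_wpDl.
  have ya : a / 2 <= `|(resid_filter eta0 y - 1) s|.
    have : a <= `|(resid_filter eta0 y - 1) s| + `|(resid_filter eta0 y - resid_filter eta0 x) s|.
      rewrite [X in _ + X](_ : _ = `|- (resid_filter eta0 y - resid_filter eta0 x) s|); last by rewrite normrN.
      apply: le_trans (ler_normD _ _); rewrite le_eqVlt; apply/orP; left.
      apply/eqP; rewrite /a; congr `| _ |; rewrite !fpsB; ring.
    by move: db; lra.
  apply: (@le_trans _ _ (a ^+ 2 / 4)).
    rewrite -[leRHS]invrK lef_pV2 ?posrE ?ltr0n ?invr_gt0 ?divr_gt0 ?exprn_gt0//.
    rewrite invf_div; apply: (@le_trans _ _ (Num.truncn (4 / a ^+ 2)).+1%:R).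
      by rewrite ltW// truncnS_gt.
    by rewrite ler_nat ltnS (leq_trans (leq_addl s _)).
  apply: (@le_trans _ _ ((resid_filter eta0 y - 1) s ^+ 2)).
    rewrite -[leRHS]real_normK ?num_real//.
    rewrite (_ : a ^+ 2 / 4 = (a / 2) ^+ 2); last by field.
    by rewrite lerXn2r ?nnegrE// divr_ge0// ltW.
  apply: (@le_trans _ _ (sq s.+1 (resid_filter eta0 y - 1))).
    by rewrite /sq big_ord_recr/= lerDr sq_ge0.
  by apply: le_sq; rewrite ltnS ltnW// ltnS leq_addr.
- move=> i j y ij yi /yi h; apply: (@le_trans _ _ i.+1%:R^-1).
    by rewrite lef_pV2 ?posrE ?ltr0n// ler_nat.
  by apply: le_trans h _; exact: le_sq.
Qed.

(** Multiplying by the inverse short-memory filter recovers (1 - z)^(-k), so Young's inequality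
    turns [sq_frac_lower] into a lower bound for the energy of the residual filter. Removing its
    leading coefficient costs exactly 1. *)
Lemma resid_filter_energy_lower (delta : R) : 0 < delta ->
  exists c : R, exists2 m0 : nat, 0 < c & forall eta m,
    (PD `\` eball eta0 delta) eta -> (m0 <= m)%N ->
    c * expR ((2 * Num.max 2^-1 (d_of eta0 - d_of eta) - 1) * ln m.+1%:R) <=
    sq m.+1 (resid_filter eta0 eta - 1).
Proof.
move=> delta0; have [i hi] := resid_filter_separated delta0.
have [S S1 hS] := short_filter_bound.
have S0 : 0 < S by apply: lt_le_trans S1.
pose c0 := i.+1%:R^-1 : R; have c00 : 0 < c0 by rewrite invr_gt0.
pose km := `|d_of eta0 - L|.
pose c1 := (S ^+ 2 * expR (2 * (km * ln (1 + km))))^-1.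
have c10 : 0 < c1 by rewrite invr_gt0 mulr_gt0 ?exprn_gt0 ?expR_gt0.
(* With E the exponential and V the energy, the entries serve three cases in turn: c1 E >= 2, where
   V >= c1 E - 1 >= c1 E / 2; c1 E < 2, where V >= c0 suffices; and d0 - d <= 1/2, where E = 1. *)
exists (Num.min (c1 / 2) (Num.min (c0 * c1 / 2) c0)), i.
  by rewrite !lt_min c00 (divr_gt0 c10)// (divr_gt0 (mulr_gt0 c00 c10)).
move=> eta m Ke im; set c := Num.min _ _.
have cc1 : c <= c1 / 2 by rewrite /c ge_min lexx.
have cc2 : c <= c0 * c1 / 2 by rewrite /c !ge_min lexx orbT.
have cc3 : c <= c0 by rewrite /c !ge_min lexx !orbT.
have V0 : c0 <= sq m.+1 (resid_filter eta0 eta - 1).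
  by apply: le_trans (hi _ Ke) _; exact: le_sq.
set V := sq m.+1 (resid_filter eta0 eta - 1) in V0 *.
set k := d_of eta0 - d_of eta.
have [kh|kh] := leP k 2^-1.
  rewrite divff ?pnatr_eq0// subrr mul0r expR0 mulr1.
  exact: le_trans V0.
have k0 : 0 <= k by apply: le_trans (ltW kh); rewrite invr_ge0.
have kkm : k <= km.
  apply: le_trans (ler_norm _); rewrite lerD2l lerN2.
  by case: Ke => -[_ /andP[]].
set E := expR _; have E0 : 0 < E by exact: expR_gt0.
have low : c1 * E <= 1 + V.
  rewrite /V -sq_resid_filter_sub1.
  have fE : frac (- k) = short_filter (theta_of eta) (theta_of eta0) * resid_filter eta0 eta.
    have -> : - k = d_of eta - d_of eta0 by rewrite /k; ring.
    by rewrite /resid_filter mulrA short_filterV mul1r.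
  have [[Pe _] _] := Ke; have [P0 _] := eta0_in.
  have h1 : sq m.+1 (frac (- k)) <= S ^+ 2 * sq m.+1 (resid_filter eta0 eta).
    rewrite fE; apply: le_trans (sqM _ _ _) _; rewrite ler_wpM2r ?sq_ge0//.
    by rewrite lerXn2r ?nnegrE ?l1_ge0 ?(ltW S0)//; exact: hS.
  rewrite /c1 invfM -mulrA ler_pdivrMl ?exprn_gt0//.
  apply: le_trans h1; apply: le_trans (sq_frac_lower m k0).
  rewrite ler_pdivlMr ?ltr0n//.
  have em : m.+1%:R = expR (ln m.+1%:R) :> R by rewrite lnK// posrE ltr0n.
  rewrite [X in _ * X <= _]em -expRN -!expRD ler_expR.
  have : k * ln (1 + k) <= km * ln (1 + km).
    apply: ler_pM => //; first by rewrite ln_ge0// lerDl.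
    by rewrite ler_ln ?posrE ?ltr_wpDr ?lerD2l// (le_trans k0).
  by move=> ?; lra.
have [E2|E2] := leP 2 (c1 * E).
  by have : c * E <= c1 / 2 * E by [rewrite ler_wpM2r// ltW]; lra.
have h2 : c * E <= c0 * c1 / 2 * E by rewrite ler_wpM2r// ltW.
have : c0 * (c1 * E) <= c0 * 2 by rewrite ler_wpM2l ?ltW.
lra.
Qed.

End Deterministic.

(** * Covering the parameter space *)

Section Net.
Variables (R : realType) (m : nat) (K : set 'rV[R]_m).

(** One representative per nonempty cell of a grid of side [r]. Representatives are taken inside
    [K], because the energy bound behind the small-ball estimate holds only there. *)
Lemma finite_net (B : nat) :
  (forall x, K x -> forall j, `|x 0 j| <= B%:R) ->
  forall r : R, 0 < r <= 1 -> exists s : seq 'rV[R]_m,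
    [/\ forall x, x \in s -> K x,
        forall x, K x -> exists2 y, y \in s & forall j, `|y 0 j - x 0 j| <= r &
        (size s)%:R <= (2 * B%:R + 1) ^+ m * r^-1 ^+ m].
Proof.
move=> KB r /andP[r0 r1].
pose N := Num.truncn (2 * B%:R / r).
pose cell (x : 'rV[R]_m) : {ffun 'I_m -> 'I_N.+1} :=
  [ffun j => inord (Num.truncn ((x 0 j + B%:R) / r))].
pose rep (c : {ffun 'I_m -> 'I_N.+1}) : option 'rV[R]_m :=
  if pselect (exists x, K x /\ cell x = c) is left e then Some (projT1 (cid e)) else None.
have repP c x : rep c = Some x -> K x /\ cell x = c.
  by rewrite /rep; case: pselect => // e [<-]; case: cid.
exists (pmap rep (enum {: {ffun 'I_m -> 'I_N.+1}})); split.
- by move=> x; rewrite mem_pmap => /mapP[c _ /esym/repP[]].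
- move=> x Kx; case e : (rep (cell x)) => [y|]; last first.
    by move: e; rewrite /rep; case: pselect => // -[]; exists x.
  have [Ky cy] := repP _ _ e; exists y.
    by rewrite mem_pmap; apply/mapP; exists (cell x); rewrite ?mem_enum.
  move=> j; have /(congr1 (fun f : {ffun 'I_m -> 'I_N.+1} => val (f j))) := cy.
  have bd (w : 'rV[R]_m) : K w -> [/\ 0 <= (w 0 j + B%:R) / r &
      (Num.truncn ((w 0 j + B%:R) / r)%R < N.+1)%N].
    move=> /KB/(_ j); rewrite ler_norml => /andP[h1 h2]; split.
      by rewrite divr_ge0 ?(ltW r0)//; lra.
    rewrite ltnS; apply: le_truncn; rewrite ler_pM2r ?invr_gt0//; lra.
  have [x0 xN] := bd _ Kx; have [y0 yN] := bd _ Ky.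
  rewrite !ffunE /= !inordK// => tE.
  have := truncn_itv x0; have := truncn_itv y0; rewrite tE.
  move: (Num.truncn _) => k /andP[y1 y2] /andP[x1 x2].
  have : `|(y 0 j + B%:R) / r - (x 0 j + B%:R) / r| <= 1.
    by rewrite ler_norml; move: y1 y2 x1 x2; rewrite -natr1 => *; apply/andP; split; lra.
  by rewrite -mulrBl normrM [`|r^-1|]gtr0_norm ?invr_gt0// ler_pdivrMr// mul1r opprD addrACA subrr addr0.
- rewrite -exprMn; apply: (@le_trans _ _ (N.+1%:R ^+ m)).
    rewrite -natrX ler_nat size_pmap; apply: leq_trans (count_size _ _) _.
    by rewrite -cardE card_ffun !card_ord.
  rewrite lerXn2r ?nnegrE ?ler0n ?mulr_ge0 ?addr_ge0 ?invr_ge0 ?(ltW r0) ?mulr_ge0//.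
  rewrite -natr1 mulrDl mul1r; apply: lerD.
    by rewrite truncn_le// divr_ge0 ?mulr_ge0// ltW.
  by rewrite -[leLHS]invr1 lef_pV2 ?posrE.
Qed.

End Net.

(** * A random envelope for the fractional integrals of the innovations *)

Section Envelope.
Variables (R : realType) (p1 p2 : nat).
Implicit Types (theta : 'rV[R]_(p1 + p2)) (eta : 'rV[R]_(p1 + p2 + 1)).
Variables (Pi : set 'rV[R]_(p1 + p2)) (L U : R) (eta0 : 'rV[R]_(p1 + p2 + 1)).
Hypothesis Pi_compact : compact Pi.
Hypothesis Pi_adm : forall theta, Pi theta -> admissible theta.
Hypothesis eta0_in : param_space Pi L U eta0.
Local Notation PD := (param_space Pi L U).
Local Notation frac h := (frac_coef h : fps R).
Local Notation ell n := (1 + ln n.+1%:R : R).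

(** Half the exponent of the normalization: a_n(d) = n^(2 [mem_exp]), the two regimes meeting at d =
    d0 - 1/2. *)
Definition mem_exp eta : R := Num.max 2^-1 (d_of eta0 - d_of eta).

Lemma rateE n eta :
  rate (d_of eta0) n.+1 (d_of eta) = expR (2 * mem_exp eta * ln n.+1%:R).
Proof.
rewrite /rate /mem_exp; case: ifPn => [h|].
  have -> : Num.max 2^-1 (d_of eta0 - d_of eta) = 2^-1 by apply/max_idPl; lra.
  by rewrite divff ?pnatr_eq0// mul1r lnK// posrE ltr0n.
rewrite -ltNge => h.
have -> : Num.max 2^-1 (d_of eta0 - d_of eta) = d_of eta0 - d_of eta.
  by apply/max_idPr; lra.
by rewrite /powR pnatr_eq0.
Qed.

Lemma mem_exp_lip eta eta' : mem_exp eta <= mem_exp eta' + `|d_of eta - d_of eta'|.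
Proof.
have h := ler_norm (- (d_of eta - d_of eta')); rewrite normrN in h.
rewrite /mem_exp ge_max -!lerBlDr !le_max; apply/andP; split; apply/orP.
  by left; rewrite lerBlDr lerDl.
by right; lra.
Qed.

(** The grid starts at the critical exponent 1/2; one mesh step changes n^(2k) by a factor of at
    most e^2. *)
Definition grid n i : R := 2^-1 + i%:R / ell n.

(* A finite maximum over a grid of mesh 1/log n controls the fractional
   integrals of all orders, as filtering by (1 - z)^h with 0 <= h <= 1 has
   l^1 norm at most 2. *)
Definition envelope J n (x : fps R) : R :=
  \sum_(i < J) expR (- (2 * grid n i * ln n.+1%:R)) *
    sq n.+1 (frac (- grid n i) * x).

Lemma envelope_ge0 J n x : 0 <= envelope J n x.
Proof. by apply: sumr_ge0 => i _; rewrite mulr_ge0 ?expR_ge0 ?sq_ge0. Qed.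

Lemma envelope_bound : exists2 M : nat,
  forall eta, PD eta -> mem_exp eta - 2^-1 <= M%:R &
  exists2 C : R, 0 <= C &
  forall eta n J x, PD eta -> (M * (Num.truncn (ell n)).+1 + 2 <= J)%N ->
    sq n.+1 (frac (d_of eta - d_of eta0) * x) <=
    C * expR (2 * mem_exp eta * ln n.+1%:R) * envelope J n x.
Proof.
pose M := (Num.truncn `|d_of eta0 - L|).+1.
(* [H] bounds the order h of the extra differencing: the gap between [mem_exp eta] and d0 - d, plus
   one mesh step, which is at most 1. *)
pose H := (Num.truncn (`|2^-1 - (d_of eta0 - U)| + 1)).+1.
have hM eta : PD eta -> mem_exp eta - 2^-1 <= M%:R.
  move=> [_ /andP[Ld _]]; have := truncnS_gt `|d_of eta0 - L|; rewrite -/M.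
  have := ler_norm (d_of eta0 - L); have := normr_ge0 (d_of eta0 - L).
  move=> *; suff : mem_exp eta <= M%:R + 2^-1 by lra.
  by rewrite /mem_exp ge_max; apply/andP; split; lra.
have hH eta : PD eta -> mem_exp eta - (d_of eta0 - d_of eta) + 1 <= H%:R.
  move=> [_ /andP[_ dU]]; have := truncnS_gt (`|2^-1 - (d_of eta0 - U)| + 1); rewrite -/H.
  have := ler_norm (2^-1 - (d_of eta0 - U)); have := normr_ge0 (2^-1 - (d_of eta0 - U)).
  move=> *; suff : mem_exp eta <= H%:R - 1 + (d_of eta0 - d_of eta) by lra.
  by rewrite /mem_exp ge_max; apply/andP; split; lra.
exists M => //; exists ((2 ^+ H) ^+ 2 * expR 2).
  by rewrite mulr_ge0 ?expR_ge0 ?exprn_ge0.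
move=> eta n J x Pe hJ.
have l1' := ell_ge1 R n; have l0 : 0 < ell n by apply: lt_le_trans l1'.
have ln0 : 0 <= ln n.+1%:R :> R by rewrite ln_ge0// ler1n.
set k := mem_exp eta.
have kh : 2^-1 <= k by rewrite /k /mem_exp le_max lexx.
(* The grid point is rounded upwards so that h >= 0, where the l^1 norm of (1 - z)^h is bounded
   uniformly in [n]. *)
pose i := (Num.truncn ((k - 2^-1) * ell n)).+1.
have t0 : 0 <= (k - 2^-1) * ell n by rewrite mulr_ge0 ?subr_ge0// ltW.
have iJ : (i < J)%N.
  apply: leq_trans hJ; rewrite addn2 !ltnS.
  rewrite truncn_le_nat -[(_ * _).+1%:R]natr1 natrM; apply: (@le_lt_trans _ _ (M%:R * (Num.truncn (ell n)).+1%:R)).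
    by apply: ler_pM; rewrite ?subr_ge0 ?(ltW l0) ?hM// ltW// truncnS_gt.
  by rewrite ltrDl.
have ki : k <= grid n i.
  by rewrite /grid -lerBlDl ler_pdivlMr// ltW// truncnS_gt.
have ik : grid n i <= k + (ell n)^-1.
  rewrite /grid /i -[(Num.truncn _).+1%:R]natr1 mulrDl mul1r addrA lerD2r -lerBrDl ler_pdivrMr//.
  by rewrite truncn_le.
pose h := grid n i - (d_of eta0 - d_of eta).
have h0 : 0 <= h.
  by rewrite subr_ge0; apply: le_trans ki; rewrite /k /mem_exp le_max lexx orbT.
have hh : h <= H%:R.
  have li : (ell n)^-1 <= 1 by rewrite invf_le1.
  by apply: le_trans (hH _ Pe); move: ik; rewrite /h /k; lra.
have -> : frac (d_of eta - d_of eta0) * x = frac h * (frac (- grid n i) * x).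
  by rewrite mulrA frac_coefD /h addrAC subrr add0r opprB.
apply: le_trans (sqM _ _ _) _; rewrite -[leRHS]mulrA -[leRHS]mulrA; apply: ler_pM.
- by rewrite exprn_ge0// l1_ge0.
- exact: sq_ge0.
- by rewrite lerXn2r ?nnegrE ?l1_ge0 ?exprn_ge0//; apply: l1_frac_le; rewrite h0.
apply: (@le_trans _ _ (expR (2 * grid n i * ln n.+1%:R) * envelope J n x)).
  rewrite -ler_pdivrMl ?expR_gt0// -expRN /envelope (bigD1 (Ordinal iJ))//= lerDl.
  by apply: sumr_ge0 => j _; rewrite mulr_ge0 ?expR_ge0 ?sq_ge0.
rewrite [leRHS]mulrA ler_wpM2r ?envelope_ge0// -expRD ler_expR.
have : grid n i * ln n.+1%:R <= (k + (ell n)^-1) * ln n.+1%:R by rewrite ler_wpM2r.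
have : (ell n)^-1 * ln n.+1%:R <= 1.
  by rewrite mulrC ler_pdivrMr// mul1r lerDr.
by move=> *; lra.
Qed.

(** Carries smallness from an arbitrary parameter to a nearby net point. The error factors through
    the fractional filter at [eta], so the envelope measures it on the scale a_n of [eta]; since r
    (1 + ln (n + 1)) <= 1, that scale is at most e^2 times the one at [eta']. *)
Lemma resid_filter_transfer (M : nat) (C0 : R) : 0 <= C0 ->
  (forall eta n J x, PD eta -> (M * (Num.truncn (ell n)).+1 + 2 <= J)%N ->
    sq n.+1 (frac (d_of eta - d_of eta0) * x) <=
    C0 * expR (2 * mem_exp eta * ln n.+1%:R) * envelope J n x) ->
  exists2 C : R, 0 <= C &
  forall eta eta' r n J x, PD eta -> PD eta' ->
    (M * (Num.truncn (ell n)).+1 + 2 <= J)%N ->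
    (forall j, `|eta' 0 j - eta 0 j| <= r) -> r * ell n <= 1 ->
    forall z : R,
    sq n.+1 ((resid_filter eta0 eta - 1) * x) <= expR (2 * mem_exp eta * ln n.+1%:R) * z ->
    sq n.+1 ((resid_filter eta0 eta' - 1) * x) <=
    expR (2 * mem_exp eta' * ln n.+1%:R) *
      (C * (z + (r * ell n) ^+ 2 * envelope J n x)).
Proof.
move=> C00 hG; have [C C1 hC] := resid_filter_lip Pi_compact Pi_adm eta0_in.
pose c := 2 + 2 * C ^+ 2 * C0.
have c0 : 0 <= c by rewrite addr_ge0// !mulr_ge0// sqr_ge0.
exists (expR 2 * c); first by rewrite mulr_ge0 ?expR_ge0.
move=> eta eta' r n J x Pe Pe' hJ ee' rl z hz.
have ln0 : 0 <= ln n.+1%:R :> R by rewrite ln_ge0// ler1n.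
have l1' := ell_ge1 R n.
have dr : `|d_of eta - d_of eta'| <= r by rewrite /d_of !mxE distrC; exact: ee'.
have r0 : 0 <= r by apply: le_trans dr.
have [D bD lD] := hC eta' eta r n Pe' Pe ee' rl.
set E := expR _ in hz; set E' := expR _.
have EE' : E <= expR 2 * E'.
  rewrite /E /E' -expRD ler_expR.
  have : mem_exp eta * ln n.+1%:R <= (mem_exp eta' + r) * ln n.+1%:R.
    rewrite ler_wpM2r//; apply: le_trans (mem_exp_lip _ eta') _.
    by rewrite lerD2l.
  have : r * ln n.+1%:R <= r * ell n by rewrite ler_wpM2l// lerDr.
  by move=> *; lra.
have G0 := envelope_ge0 J n x.
have z0 : 0 <= z.
  have : 0 <= E * z by apply: le_trans hz; exact: sq_ge0.
  by rewrite pmulr_rge0// expR_gt0.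
have -> : (resid_filter eta0 eta' - 1) * x =
    (resid_filter eta0 eta - 1) * x + D * (frac (d_of eta - d_of eta0) * x).
  by rewrite mulrA -bD; ring.
apply: le_trans (sqD _ _ _) _.
have h2 : sq n.+1 (D * (frac (d_of eta - d_of eta0) * x)) <=
    (C * (r * ell n)) ^+ 2 * (C0 * E * envelope J n x).
  apply: le_trans (sqM _ _ _) _; apply: ler_pM; rewrite ?sq_ge0 ?sqr_ge0//.
    by rewrite lerXn2r ?nnegrE ?l1_ge0//; apply: le_trans lD; exact: l1_ge0.
  exact: hG.
set q := (r * ell n) ^+ 2 * envelope J n x.
have q0 : 0 <= q by rewrite mulr_ge0// sqr_ge0.
apply: (@le_trans _ _ (E * (c * (z + q)))).
  rewrite [leRHS](_ : _ = 2 * (E * z) + 2 * (C ^+ 2 * C0 * E * q) + (2 * E * q +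
    2 * C ^+ 2 * C0 * E * z)); last by rewrite /c; ring.
  have -> : C ^+ 2 * C0 * E * q = (C * (r * ell n)) ^+ 2 * (C0 * E * envelope J n x).
    by rewrite /q; ring.
  have : 0 <= 2 * E * q + 2 * C ^+ 2 * C0 * E * z.
    have E0 : 0 <= E by exact: expR_ge0.
    apply: addr_ge0; first by apply: mulr_ge0 => //; apply: mulr_ge0.
    by do 4!apply: mulr_ge0 => //; exact: sqr_ge0.
  by move: hz h2; lra.
rewrite -[expR 2 * c * _]mulrA [leRHS]mulrA; apply: ler_wpM2r.
  by rewrite mulr_ge0// addr_ge0.
by rewrite mulrC.
Qed.

End Envelope.

(** * Independence and small balls *)

Section Independence.
Context {disp : measure_display} {T : measurableType disp} {R : realType}.
Variable P : probability T R.

Lemma probability_setIC_indep (A B : set T) : measurable A -> measurable B ->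
  (P (A `&` B) = P A * P B)%E -> (P (~` A `&` B) = P (~` A) * P B)%E.
Proof.
move=> mA mB AB.
have -> : ~` A `&` B = B `\` (A `&` B).
  apply/seteqP; split => [w [nA Bw]|w [Bw nAB]]; split => // Aw.
    by move: Aw => [].
  by apply: nAB.
transitivity (P B - P (A `&` B))%E.
  rewrite measureD//; [|exact: measurableI|by rewrite -ge0_fin_numE// fin_num_measure].
  by rewrite setICA setIid.
rewrite AB probability_setC//.
rewrite -(fineK (fin_num_measure P A mA)) -(fineK (fin_num_measure P B mB)).
by rewrite -EFinM -!EFinB -EFinM; congr EFin; ring.
Qed.

(* One step of Dynkin's pi-lambda argument. *)
Lemma indep_generated (G : set (set T)) (B : set T) :
  setI_closed G -> G `<=` measurable -> measurable B ->
  (forall A, G A -> P (A `&` B) = P A * P B)%E ->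
  forall A, <<s G >> A -> measurable A /\ (P (A `&` B) = P A * P B)%E.
Proof.
move=> GI Gm mB GB.
pose H := [set A | measurable A /\ (P (A `&` B) = P A * P B)%E].
suff h : <<s G >> `<=` H by move=> A /h.
apply: lambda_system_subset => //; last first.
  by move=> A GA; split; [exact: Gm|exact: GB].
apply/dynkin_lambda_system; split.
- by split => //; rewrite setTI probability_setT mul1e.
- move=> A [mA AB]; split; first exact: measurableC.
  exact: probability_setIC_indep.
- move=> F tF HF; split; first by apply: bigcup_measurable => k _; case: (HF k).
  rewrite setI_bigcupl measure_bigcup//; last 2 first.
    by move=> k _; apply: measurableI => //; case: (HF k).
    exact: trivIset_setIr.
  rewrite measure_bigcup//; last by move=> k _; case: (HF k).
  have -> : P B = (fine (P B))%:E by rewrite fineK// fin_num_measure.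
  rewrite muleC -nneseriesZl//.
  apply: eq_eseriesr => k _; rewrite fineK ?fin_num_measure// muleC.
  by case: (HF k).
Qed.

Variable eps : nat -> {RV P >-> R}.

Definition cylinders (S : seq nat) : set (set T) :=
  [set A | exists2 E : nat -> set R, (forall t, measurable (E t)) &
     A = \bigcap_(t in [set` S]) (eps t @^-1` E t)].

Lemma cylinders_setI S : setI_closed (cylinders S).
Proof.
move=> _ _ [E mE ->] [F mF ->]; exists (fun t => E t `&` F t).
  by move=> t; exact: measurableI.
by rewrite -bigcapI; apply: eq_bigcapr => t _; rewrite preimage_setI.
Qed.

Lemma cylinders_measurable S : cylinders S `<=` measurable.
Proof.
move=> _ [E mE ->]; apply: bigcap_measurableType => t _.
by rewrite -[X in measurable X]setTI; exact: measurable_funP.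
Qed.

Hypothesis eps_indep : independent_innovations eps.

(** Two uses of [indep_generated]: the first sigma-algebra against a fixed cylinder of the second,
    then the second against a fixed event of the first. *)
Lemma sigma_cylinders_indep (S1 S2 : seq nat) A B : uniq (S1 ++ S2) -> all (leq 1) (S1 ++ S2) ->
  <<s cylinders S1 >> A -> <<s cylinders S2 >> B ->
  [/\ measurable A, measurable B & (P (A `&` B) = P A * P B)%E].
Proof.
move=> uS pS sA sB.
have base C D : cylinders S1 C -> cylinders S2 D -> (P (C `&` D) = P C * P D)%E.
  move=> [E mE ->] [F mF ->].
  pose H t := if t \in S1 then E t else F t.
  have mH t : measurable (H t) by rewrite /H; case: ifP.
  have := eps_indep uS pS mH; rewrite big_cat/=.
  move: uS pS; rewrite cat_uniq all_cat => /and3P[u1 /hasPn S21 u2] /andP[p1 p2].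
  have e1 : (\prod_(t <- S1) P (eps t @^-1` H t) = P (\bigcap_(t in [set` S1]) (eps t @^-1` E t)))%E.
    rewrite eps_indep// !big_seq; apply: eq_bigr => t tS; by rewrite /H tS.
  have e2 : (\prod_(t <- S2) P (eps t @^-1` H t) = P (\bigcap_(t in [set` S2]) (eps t @^-1` F t)))%E.
    rewrite eps_indep// !big_seq; apply: eq_bigr => t tS.
    by rewrite /H (negbTE (S21 t tS)).
  rewrite e1 e2 => <-; congr (P _).
  apply/seteqP; split => [w [h1 h2] t|w h].
    rewrite /= mem_cat /H => /orP[tS|tS]; first by rewrite tS; exact: h1.
    by rewrite (negbTE (S21 t tS)); exact: h2.
  split => t /= tS; have := h t; rewrite /= mem_cat tS ?orbT /H.
    by rewrite tS => /(_ isT).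
  by rewrite (negbTE (S21 t tS)) => /(_ isT).
have step D : cylinders S2 D -> measurable A /\ (P (A `&` D) = P A * P D)%E.
  move=> GD; apply: (indep_generated (@cylinders_setI S1) (@cylinders_measurable S1)) => //.
    exact: cylinders_measurable GD.
  by move=> C GC; exact: base.
have mA : measurable A.
  have := @indep_generated _ setT (@cylinders_setI S1) (@cylinders_measurable S1) measurableT.
  case/(_ _ A sA) => // C /cylinders_measurable mC.
  by rewrite setIT probability_setT mule1.
have [] := @indep_generated _ A (@cylinders_setI S2) (@cylinders_measurable S2) mA _ B sB.
  by move=> D /step[_]; rewrite setIC muleC.
by move=> mB; rewrite setIC muleC.
Qed.

Lemma measurable_cylinder_form S (I : Type) (r : seq I) (c : I -> R) (f : I -> nat)
    (Q : pred I) : (forall i, Q i -> f i \in S) ->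
  @measurable_fun _ _ (g_sigma_algebraType (cylinders S)) R setT
    (fun w => \sum_(i <- r | Q i) c i * eps (f i) w).
Proof.
move=> fS; have me t : t \in S ->
    @measurable_fun _ _ (g_sigma_algebraType (cylinders S)) R setT (eps t).
  move=> tS _ Y mY; rewrite setTI; apply: sub_sigma_algebra.
  exists (fun s => if s == t then Y else setT); first by move=> s; case: ifP.
  apply/seteqP; split => [w Yw s _ /=|w /(_ t tS)]; last by rewrite /= eqxx.
  by case: eqP => [->|].
under eq_fun do rewrite big_mkcond.
apply: measurable_sum => i; case Qi : (Q i); last exact: measurable_cst.
apply: measurable_funM; first exact: measurable_cst.
by apply: me; apply: fS; rewrite Qi.
Qed.

Lemma cylinder_event S (I : Type) (r : seq I) (c : I -> R) (f : I -> nat)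
    (Q : pred I) (Y : set R) : (forall i, Q i -> f i \in S) -> measurable Y ->
  <<s cylinders S >> [set w | Y (\sum_(i <- r | Q i) c i * eps (f i) w)].
Proof.
move=> fS mY; have := measurable_cylinder_form r c fS.
by move=> /(_ measurableT _ mY); rewrite setTI.
Qed.

End Independence.

(** * Concentration of linear forms from (A1) *)

Section SmallBall.
Context {disp : measure_display} {T : measurableType disp} {R : realType}.
Variable P : probability T R.
Variable eps : nat -> {RV P >-> R}.
Hypothesis eps_A1 : condition_A1 eps.

Definition innov_form (c : nat -> R) (t : nat) (w : T) : R :=
  \sum_(s < t) c s * eps s.+1 w.

Lemma measurable_innov_form c t : measurable_fun setT (innov_form c t).
Proof.
by apply: measurable_sum => i; apply: measurable_funM => //; exact: measurable_cst.
Qed.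

Lemma measurable_innov_form_event c t (Y : set R) : measurable Y ->
  measurable [set w | Y (innov_form c t w)].
Proof.
by move=> mY; rewrite -[X in measurable X]setTI; exact: (measurable_innov_form c t).
Qed.

Lemma measurable_segment_set (lo hi : R) : measurable [set x : R | lo <= x <= hi].
Proof. by rewrite -set_itvcc; exact: measurable_itv. Qed.

Lemma innov_form_concentration : exists M alpha : R, [/\ 0 < M, 0 < alpha &
  forall (t : nat) (c : nat -> R) (lo h : R), 0 < \sum_(s < t) c s ^+ 2 -> 0 < h ->
  (P [set w | (lo <= innov_form c t w <= lo + h)%R] <=
    (M * (h / Num.sqrt (\sum_(s < t) c s ^+ 2)) `^ alpha)%:E)%E].
Proof.
have [d0 [a [M1 [/andP[d00 d01] /andP[a0 a1] M10 hA1]]]] := eps_A1.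
exists (Num.max (M1 * 2 `^ a) ((2 / d0) `^ a)), a; split => //.
  by rewrite lt_max; apply/orP; left; rewrite mulr_gt0// powR_gt0.
move=> t c lo h V0 h0; set V := \sum_(s < t) _ in V0 *.
pose s := Num.sqrt V; have s0 : 0 < s by rewrite sqrtr_gt0.
have hs0 : 0 < h / s by rewrite divr_gt0.
(* Beyond the range of (A1) the second constant makes the bound at least 1. *)
have [big|small] := ltP d0 (2 * (h / s)).
  apply: (@le_trans _ _ 1%E).
    exact: probability_le1 (measurable_innov_form_event c t (measurable_segment_set _ _)).
  rewrite lee_fin; apply: (@le_trans _ _ ((2 / d0) `^ a * (h / s) `^ a)); last first.
    by rewrite ler_wpM2r ?powR_ge0// le_max lexx orbT.
  rewrite -powRM ?divr_ge0 ?(ltW s0) ?(ltW h0) ?(ltW d00)//.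
  apply: (@le_trans _ _ (1 `^ a)); first by rewrite powR1.
  have k1 : 1 <= 2 / d0 * (h / s).
    by rewrite mulrAC ler_pdivlMr// mul1r ltW.
  by apply: ge0_ler_powR; rewrite ?nnegrE ?(ltW a0)// (le_trans ler01).
(* The vector in (A1) lists the innovations backwards in time, hence the reversal of [c]. *)
pose u : 'rV[R]_t := \row_i (c (t - i).-1 / s).
have uE w : lincomb eps u w = innov_form c t w / s.
  rewrite /lincomb /innov_form mulr_suml [RHS](reindex_inj rev_ord_inj)/=.
  apply: eq_bigr => i _; rewrite mxE.
  have -> : (t - i = (t - i.+1).+1)%N by rewrite subnSK.
  by rewrite /= mulrAC.
have nu : enorm u = 1.
  rewrite /enorm -[RHS]sqrtr1; congr Num.sqrt.
  rewrite (eq_bigr (fun i : 'I_t => c (t - i.+1)%N ^+ 2 / V)); last first.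
    move=> i _; rewrite mxE exprMn exprVn sqr_sqrtr ?(ltW V0)//.
    by congr (c _ ^+ 2 / _); rewrite subnS.
  rewrite -mulr_suml (_ : \sum_(i < t) _ = V) ?divff ?gt_eqF//.
  by rewrite /V [RHS](reindex_inj rev_ord_inj).
have t0 : (1 <= t)%N.
  by rewrite lt0n; apply/eqP => t0; move: V0; rewrite /V t0 big_ord0 ltxx.
(* Differences of distribution functions measure half-open intervals; the closed segment is put into
   ]lo - h, lo + h], which is twice as long and accounts for 2^a in the constant. *)
pose v := (lo - h) / s; pose r := (lo + h) / s.
have rv : r - v = 2 * (h / s).
  by rewrite /r /v -mulrBl mulrA; congr (_ / _); ring.
have vr : v <= r by rewrite -subr_ge0 rv mulr_ge0// ltW.
have : (`|lincomb_cdf eps u r - lincomb_cdf eps u v| <= (M1 * (r - v) `^ a)%:E)%E.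
  apply: le_trans (hA1 r v _); last by rewrite rv small mulr_gt0.
  by apply: ereal_sup_ubound; exists t, u.
rewrite rv powRM ?(ltW hs0)// mulrA => hcdf.
apply: (@le_trans _ _ (M1 * 2 `^ a * (h / s) `^ a)%:E); last first.
  by rewrite lee_fin ler_wpM2r ?powR_ge0// le_max lexx.
apply: le_trans hcdf.
have mI (x : R) : measurable `]-oo, x]%classic by exact: measurable_itv.
pose X := lincomb eps u.
have mX (Y : set R) : measurable Y -> measurable (X @^-1` Y).
  by move=> mY; rewrite -[_ @^-1` _]setTI; exact: (measurable_lincomb eps u).
have -> : (lincomb_cdf eps u r - lincomb_cdf eps u v = P (X @^-1` (`]-oo, r] `\` `]-oo, v])))%E.
  transitivity (P (X @^-1` `]-oo, r]) - P (X @^-1` `]-oo, v]))%E => //.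
  rewrite (_ : X @^-1` (_ `\` _) = X @^-1` `]-oo, r] `\` X @^-1` `]-oo, v])//.
  rewrite [RHS]measureD; last 3 first.
  - exact: mX.
  - exact: mX.
  - by rewrite -ge0_fin_numE// fin_num_measure//; exact: mX.
  congr (_ - P _)%E; rewrite -preimage_setI; congr (_ @^-1` _).
  apply/seteqP; split => x /=; rewrite !in_itv/=; last by case.
  by move=> xv; split=> //; apply: le_trans vr.
rewrite gee0_abs//; apply: le_measure; rewrite ?inE.
- exact: (measurable_innov_form_event c t (measurable_segment_set _ _)).
- by apply: mX; apply: measurableD.
move=> w /= /andP[w1 w2]; rewrite /X uE !in_itv/=; split.
  by rewrite ler_pM2r ?invr_gt0.
apply/negP; rewrite -ltNge ltr_pM2r ?invr_gt0//; lra.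
Qed.

End SmallBall.

Lemma sum_tail (R : nmodType) (F G : nat -> R) p q : (p <= q)%N ->
  (forall s, (s < p)%N -> F s = 0) ->
  (forall s, (p <= s < q)%N -> F s = G s) ->
  \sum_(s < q) F s = \sum_(p <= s < q) G s.
Proof.
move=> pq F0 FG; rewrite -(big_mkord xpredT F) (big_cat_nat (leq0n p) pq)/=.
rewrite (eq_big_nat _ _ (F2 := fun=> 0)) ?big1_eq ?add0r; first exact: eq_big_nat.
by move=> i /andP[_ /F0].
Qed.

Section SmallBallChain.
Context {disp : measure_display} {T : measurableType disp} {R : realType}.
Variable P : probability T R.
Variable eps : nat -> {RV P >-> R}.
Hypothesis eps_indep : independent_innovations eps.
Variables M alpha : R.
Hypotheses (M0 : 0 < M) (alpha0 : 0 < alpha).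
Hypothesis conc : forall (t : nat) (c : nat -> R) (lo h : R),
  0 < \sum_(s < t) c s ^+ 2 -> 0 < h ->
  (P [set w | (lo <= innov_form eps c t w <= lo + h)%R] <=
    (M * (h / Num.sqrt (\sum_(s < t) c s ^+ 2)) `^ alpha)%:E)%E.

Let past p := <<s cylinders eps (iota 1 p) >>.

Lemma past_innov_form p q (c : nat -> R) (Y : set R) : (q <= p)%N -> measurable Y ->
  past p [set w | Y (innov_form eps c q w)].
Proof.
move=> qp mY; rewrite /past.
apply: (cylinder_event (index_enum 'I_q) (fun s : 'I_q => c s)
  (f := fun s : 'I_q => s.+1) (Q := xpredT)) => // i _.
by rewrite mem_iota/= add1n ltnS; exact: leq_trans (ltn_ord i) qp.
Qed.

Lemma pastI p A B : past p A -> past p B -> past p (A `&` B).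
Proof.
move=> pA pB.
exact: (@measurableI _ (g_sigma_algebraType (cylinders eps (iota 1 p))) A B pA pB).
Qed.

Lemma past_measurable p A : past p A -> measurable A.
Proof.
move=> pA.
have u : uniq (iota 1 p ++ [::]) by rewrite cats0 iota_uniq.
have a : all (leq 1) (iota 1 p ++ [::]).
  by rewrite cats0; apply/allP => i; rewrite mem_iota => /andP[].
have s0 : <<s cylinders eps [::] >> set0 by exact: sigma_algebra0.
by have [] := sigma_cylinders_indep eps_indep u a pA s0.
Qed.

(* Conditionally on the past, the form is an independent form Z plus a
   constant; the past value of the remainder is discretized in cells of
   width [h], so that no conditional distribution is needed. *)
Lemma small_ball_step p q (c : nat -> R) (V h : R) A : (p <= q)%N ->
  0 < V -> V <= \sum_(p <= s < q) c s ^+ 2 -> 0 < h -> past p A ->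
  (P (A `&` [set w | (- h <= innov_form eps c q w <= h)%R]) <=
    P A * (M * (3 * h / Num.sqrt V) `^ alpha)%:E)%E.
Proof.
move=> pq V0 hV h0 pA.
pose cZ s := if (s < p)%N then 0 else c s.
pose X := innov_form eps c q; pose Y := innov_form eps c p; pose Z := innov_form eps cZ q.
have XE w : X w = Y w + Z w.
  rewrite /X /Y /Z /innov_form -!(big_mkord xpredT (fun s => c s * eps s.+1 w)).
  rewrite (big_cat_nat (leq0n p) pq)/=; congr (_ + _); apply/esym.
  apply: (sum_tail (F := fun s => cZ s * eps s.+1 w)) => // s.
    by rewrite /cZ => ->; rewrite mul0r.
  by move=> /andP[ps _]; rewrite /cZ ltnNge ps.
have ZE w : Z w = \sum_(i <- index_iota p q | (p <= i < q)%N) c i * eps i.+1 w.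
  rewrite -big_nat; apply: (sum_tail (F := fun s => cZ s * eps s.+1 w)) => // s.
    by rewrite /cZ => ->; rewrite mul0r.
  by move=> /andP[ps _]; rewrite /cZ ltnNge ps.
have VZ : V <= \sum_(s < q) cZ s ^+ 2.
  rewrite (sum_tail (F := fun s => cZ s ^+ 2) (G := fun s => c s ^+ 2) pq)// => s.
    by rewrite /cZ => ->; rewrite expr0n.
  by move=> /andP[ps _]; rewrite /cZ ltnNge ps.
set b := M * _.
have b0 : 0 <= b by rewrite mulr_ge0 ?powR_ge0 ?ltW.
(* [pickle] numbers the integer cells by naturals, so that they form a countable partition. *)
pose cl (x : R) : nat := pickle (Num.floor (x / h)).
pose F k := A `&` [set w | cl (Y w) = k].
pose E := [set w | - h <= X w <= h].
have mE : measurable E by exact: measurable_innov_form_event (measurable_segment_set _ _).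
have clE (j : int) : [set x | cl x = pickle j] = `[j%:~R * h, (j + 1)%:~R * h[%classic.
  apply/seteqP; split => x /=; rewrite in_itv/=.
    move=> /(pcan_inj (@pickleK _)) <-.
    by rewrite -ler_pdivlMr// -ltr_pdivrMr// floor_itv.
  rewrite -ler_pdivlMr// -ltr_pdivrMr// => jx.
  by rewrite /cl; congr pickle; exact: floor_def.
have FE k : (forall w, ~ F k w) \/ exists j : int, k = pickle j.
  have [[w Fw]|] := pselect (exists w, F k w); last by move=> nF; left => w Fw; apply: nF; exists w.
  by right; exists (Num.floor (Y w / h)); case: Fw.
have pF k : past p (F k).
  have [F0|[j kj]] := FE k.
    by rewrite (_ : F k = set0); [exact: sigma_algebra0|apply/seteqP; split => // w /F0].
  apply: pastI => //.
  have := @past_innov_form p p c [set x | cl x = k] (leqnn p); apply.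
  by rewrite kj clE; exact: measurable_itv.
have mF k : measurable (F k) by exact: past_measurable (pF k).
have tF : trivIset setT F.
  by move=> i j _ _ [w [[_ <-] [_ <-]]].
have AF : A = \bigcup_k F k.
  apply/seteqP; split => [w Aw|w [k _ []//]].
  by exists (cl (Y w)).
have cell k : (P (F k `&` E) <= b%:E * P (F k))%E.
  have [F0|[j kj]] := FE k.
    rewrite (_ : F k = set0) ?set0I ?measure0 ?mule0//.
    by apply/seteqP; split => // w /F0.
  (* In cell [j] the past part lies in [jh, (j + 1)h[, so |X| <= h confines [Z] to
     [-h - (j + 1)h, h - jh], of length 3h. *)
  pose lo := - h - (j + 1)%:~R * h.
  pose B := [set w | lo <= Z w <= lo + 3 * h].
  have sub : F k `&` E `<=` F k `&` B.
    move=> w [Fw /andP[e1 e2]]; split => //; rewrite /B/=.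
    have [_ /= ck] := Fw; have : [set x | cl x = pickle j] (Y w) by rewrite /= -kj.
    rewrite clE /= in_itv/= => /andP[y1 y2].
    rewrite XE in e1 e2; rewrite /lo; move: y1 y2 e1 e2.
    rewrite intrD mulrDl mul1r => *; apply/andP; split; lra.
  have sB : <<s cylinders eps (iota p.+1 (q - p)) >> B.
    rewrite (_ : B = [set w | [set x | lo <= x <= lo + 3 * h]
        (\sum_(i <- index_iota p q | (p <= i < q)%N) c i * eps i.+1 w)]); last first.
      by apply/funext => w; rewrite /B/= ZE.
    apply: cylinder_event; last exact: measurable_segment_set.
    by move=> i /andP[pi iq]; rewrite mem_iota ltnS pi/= addSn ltnS subnKC.
  have u : uniq (iota 1 p ++ iota p.+1 (q - p)).
    by rewrite -[p.+1]add1n -iotaD iota_uniq.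
  have a : all (leq 1) (iota 1 p ++ iota p.+1 (q - p)).
    by rewrite -[p.+1]add1n -iotaD; apply/allP => i; rewrite mem_iota => /andP[].
  have [_ mB FB] := sigma_cylinders_indep eps_indep u a (pF k) sB.
  apply: (@le_trans _ _ (P (F k `&` B))).
    by apply: le_measure; rewrite ?inE//; apply: measurableI.
  rewrite FB muleC; apply: lee_wpmul2r => //.
  apply: le_trans (conc _ _ _) _; [exact: lt_le_trans VZ|by rewrite mulr_gt0|].
  rewrite lee_fin ler_wpM2l ?(ltW M0)//; apply: ge0_ler_powR; rewrite ?nnegrE ?(ltW alpha0)//.
  - by rewrite divr_ge0 ?mulr_ge0 ?sqrtr_ge0// ltW.
  - by rewrite divr_ge0 ?mulr_ge0 ?sqrtr_ge0// ltW.
  rewrite ler_wpM2l ?mulr_ge0 ?(ltW h0)// lef_pV2 ?posrE ?sqrtr_gt0 ?(lt_le_trans V0)//.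
  exact: ler_wsqrtr.
rewrite muleC {1}AF setI_bigcupl measure_bigcup//; last 2 first.
  by move=> k _; exact: measurableI.
  exact: trivIset_setIr.
rewrite [X in P X]AF measure_bigcup//.
rewrite -nneseriesZl//; apply: lee_nneseries => // k _; exact: cell.
Qed.

(** The first k' events lie in the past of [tau k'], so each further time contributes one factor,
    governed only by the innovations that arrived since the previous time. *)
Lemma small_ball_chain (c : nat -> nat -> R) (tau : nat -> nat) (V h : R) k :
  (forall i, (tau i <= tau i.+1)%N) -> 0 < V -> 0 < h ->
  (forall i, (i < k)%N -> V <= \sum_(tau i <= s < tau i.+1) c i s ^+ 2) ->
  (P [set w | forall i, (i < k)%N -> (- h <= innov_form eps (c i) (tau i.+1) w <= h)%R] <=
    ((M * (3 * h / Num.sqrt V) `^ alpha) ^+ k)%:E)%E.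
Proof.
move=> mono V0 h0 hV; set b := M * _.
have b0 : 0 <= b by rewrite mulr_ge0 ?powR_ge0 ?ltW.
pose A k := [set w | forall i, (i < k)%N -> (- h <= innov_form eps (c i) (tau i.+1) w <= h)%R].
have AS k' : A k'.+1 = A k' `&` [set w | (- h <= innov_form eps (c k') (tau k'.+1) w <= h)%R].
  apply/seteqP; split => w.
    by move=> Aw; split => [i ik|]; apply: Aw => //; rewrite ltnS ltnW.
  move=> [Aw Bw] i; rewrite ltnS leq_eqVlt => /orP[/eqP ->//|]; exact: Aw.
have pA k' : past (tau k') (A k').
  have mt i j : (i <= j)%N -> (tau i <= tau j)%N.
    by move=> /subnK <-; elim: (j - i)%N => // m IH; apply: leq_trans IH _; rewrite addSn.
  suff h' : forall m, (k' <= m)%N -> past (tau m) (A k') by exact: h'.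
  elim: k' => [|k' IH] m km.
    have -> : A 0%N = ~` set0 by rewrite setC0; apply/seteqP; split.
    by rewrite /past; apply: sigma_algebraC; exact: sigma_algebra0.
  rewrite AS; apply: pastI; first by apply: IH; exact: ltnW.
  exact: (past_innov_form (c k') (mt _ _ km) (measurable_segment_set (- h) h)).
suff : forall k', (k' <= k)%N -> (P (A k') <= (b ^+ k')%:E)%E by move/(_ k (leqnn k)).
elim=> [|k' IH] kk; first by rewrite expr0; exact: probability_le1 (past_measurable (pA 0%N)).
rewrite AS; apply: le_trans (small_ball_step (mono k') V0 (hV _ kk) h0 (pA k')) _.
by rewrite exprSr [X in (_ <= X)%E]EFinM; apply: lee_wpmul2r; [rewrite lee_fin|exact/IH/ltnW].
Qed.

End SmallBallChain.

(** * Second moments *)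

Section SecondMoment.
Context {disp : measure_display} {T : measurableType disp} {R : realType}.
Variable P : probability T R.

(** The joint law is the product law, and by Fubini the inner integral at each x is x E[Y] = 0. *)
Lemma integral_mul_indep (X Y : {RV P >-> R}) :
  (forall A B : set R, measurable A -> measurable B ->
    P (X @^-1` A `&` Y @^-1` B) = P (X @^-1` A) * P (Y @^-1` B))%E ->
  P.-integrable setT (EFin \o Y) ->
  P.-integrable setT (fun w => (X w * Y w)%:E) ->
  (\int[P]_w (Y w)%:E = 0)%E -> (\int[P]_w (X w * Y w)%:E = 0)%E.
Proof.
move=> ind iY iXY EY.
pose phi0 w := (X w, Y w).
have mphi : measurable_fun setT phi0 by exact: measurable_fun_pair.
pose mix := isMeasurableFun.Build _ _ _ _ phi0 mphi.
pose phi : {mfun T >-> (R * R)%type} := HB.pack phi0 mix.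
pose f (z : R * R) := (z.1 * z.2)%:E.
have mf : measurable_fun setT f.
  by apply/measurable_EFinP; apply: measurable_funM.
have law A : measurable A ->
    ((distribution P X \x distribution P Y) A = distribution P phi A)%E.
  by move=> mA; apply: product_measure_unique => // B C mB mC; exact: ind.
have if2 : (distribution P phi).-integrable setT f.
  apply: integrable_pushforward => //.
have if1 : (distribution P X \x distribution P Y)%E.-integrable setT f.
  apply/integrableP; split => //; have /integrableP[_] := if2.
  suff -> : (\int[distribution P X \x distribution P Y]_z `|f z| =
      \int[distribution P phi]_z `|f z|)%E by [].
  by apply: eq_measure_integral => A mA _; exact: law.
transitivity (\int[distribution P phi]_z f z)%E.
  by rewrite integral_pushforward.
transitivity (\int[(distribution P X \x distribution P Y)%E]_z f z)%E.
  by apply: eq_measure_integral => A mA _; apply/esym; exact: law.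
rewrite -integral12_prod_meas1//; apply: integral0_eq => x _.
rewrite /fubini_F /f/=.
under eq_integral do rewrite EFinM.
rewrite integralZl//; last first.
  by apply: integrable_pushforward.
by rewrite integral_pushforward// EY mule0.
Qed.

Variable eps : nat -> {RV P >-> R}.
Variable sigma : R.
Hypothesis eps_indep : independent_innovations eps.
Hypothesis eps_mean : forall t, (1 <= t)%N -> ('E_P[eps t] = 0)%E.
Hypothesis eps_var : forall t, (1 <= t)%N ->
  ('E_P[fun w => (eps t w ^+ 2)%R] = (sigma ^+ 2)%:E)%E.

Lemma integrable_innov_sqr t :
  P.-integrable setT (fun w => (eps t.+1 w ^+ 2)%:E).
Proof.
apply/integrableP; split.
  by apply/measurable_EFinP; exact: measurable_funX.
rewrite (eq_integral (fun w => (eps t.+1 w ^+ 2)%:E)); last first.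
  by move=> w _; rewrite gee0_abs// lee_fin sqr_ge0.
by have := eps_var (ltn0Sn t); rewrite unlock => ->; exact: ltry.
Qed.

Lemma integrable_innov_mul s t :
  P.-integrable setT (fun w => (eps s.+1 w * eps t.+1 w)%:E).
Proof.
apply: (le_integrable measurableT (g := fun w =>
  ((eps s.+1 w ^+ 2)%:E + (eps t.+1 w ^+ 2)%:E)%E)).
- by apply/measurable_EFinP; exact: measurable_funM.
- move=> w _; rewrite -EFinD !abse_EFin lee_fin normrM [leRHS]ger0_norm ?addr_ge0 ?sqr_ge0//.
  rewrite -[X in _ <= X + _]real_normK ?num_real// -[X in _ <= _ + X]real_normK ?num_real//.
  set x := `|_|; set y := `|_|.
  have := sqr_ge0 (x - y); have : 0 <= x * y by rewrite mulr_ge0 /x /y ?normr_ge0.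
  by rewrite sqrrB; lra.
by apply: integrableD => //; exact: integrable_innov_sqr.
Qed.

Lemma integrable_innov t : P.-integrable setT (EFin \o eps t.+1).
Proof.
apply: (le_integrable measurableT (g := fun w =>
  ((eps t.+1 w ^+ 2)%:E + (cst 1%:E : T -> \bar R) w)%E)).
- by apply/measurable_EFinP; exact: measurable_funP.
- move=> w _ /=; rewrite lee_fin [leRHS]ger0_norm ?addr_ge0 ?sqr_ge0//.
  rewrite -[X in _ <= X + _]real_normK ?num_real//; set x := `|_|.
  by have := sqr_ge0 (x - 1); have := normr_ge0 (eps t.+1 w); rewrite -/x; rewrite sqrrB; lra.
apply: integrableD => //; first exact: integrable_innov_sqr.
exact: (finite_measure_integrable_cst P 1 measurableT).
Qed.

Lemma integral_innov_mul s t :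
  (\int[P]_w (eps s.+1 w * eps t.+1 w)%:E = (sigma ^+ 2 * (s == t)%:R)%:E)%E.
Proof.
have [->|st] := eqVneq s t.
  have := eps_var (ltn0Sn t); rewrite unlock mulr1 => <-.
  by apply: eq_integral => w _; rewrite expr2.
rewrite mulr0; apply: integral_mul_indep.
- move=> A B mA mB.
  have u : uniq [:: s.+1; t.+1] by rewrite /= inE eqSS st.
  have := eps_indep u isT (E := fun i => if i == s.+1 then A else B).
  rewrite !big_cons big_nil eqxx eqSS eq_sym (negbTE st) mule1 => <-; last by move=> i; case: ifP.
  congr (P _); apply/seteqP; split => [w [Aw Bw] i|w h].
    by rewrite /= !inE => /orP[]/eqP ->; rewrite ?eqxx// eqSS eq_sym (negbTE st).
  split; first by have := h s.+1; rewrite /= inE eqxx => /(_ isT).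
  by have := h t.+1; rewrite /= !inE eqxx orbT eqSS eq_sym (negbTE st) => /(_ isT).
- exact: integrable_innov.
- exact: integrable_innov_mul.
- by have := eps_mean (ltn0Sn t); rewrite unlock.
Qed.

Lemma integral_innov_form_sqr c t :
  (\int[P]_w (innov_form eps c t w ^+ 2)%:E = (sigma ^+ 2 * \sum_(s < t) c s ^+ 2)%:E)%E.
Proof.
transitivity (\int[P]_w (\sum_(k : 'I_t * 'I_t)
    ((c k.1 * c k.2)%:E * (eps k.1.+1 w * eps k.2.+1 w)%:E)))%E.
  apply: eq_integral => w _; rewrite (eq_bigr (fun k : 'I_t * 'I_t =>
    (c k.1 * eps k.1.+1 w * (c k.2 * eps k.2.+1 w))%:E)); last first.
    by move=> k _; rewrite -EFinM mulrACA.
  rewrite sumEFin -(pair_bigA _ (fun i j : 'I_t => c i * eps i.+1 w * (c j * eps j.+1 w)))/=.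
  congr EFin; rewrite expr2 /innov_form mulr_suml; apply: eq_bigr => i _.
  by rewrite mulr_sumr.
rewrite integral_sum//; last first.
  by move=> k; apply: integrableZl => //; exact: integrable_innov_mul.
rewrite (eq_bigr (fun k : 'I_t * 'I_t =>
    (c k.1 * c k.2 * (sigma ^+ 2 * (k.1 == k.2)%:R))%:E)); last first.
  move=> k _; rewrite integralZl//; last exact: integrable_innov_mul.
  by rewrite integral_innov_mul EFinM.
rewrite sumEFin -(pair_bigA _ (fun i j : 'I_t => c i * c j * (sigma ^+ 2 * (i == j)%:R)))/=.
congr EFin; rewrite mulr_sumr; apply: eq_bigr => i _.
rewrite (bigD1 i)//= eqxx big1 ?addr0; first by rewrite mulr1 mulrC expr2.
by move=> j ji; rewrite eq_sym (negbTE ji) !mulr0.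
Qed.

End SecondMoment.

(** * Small values of the sum of squares *)

Section Averaging.
Context {disp : measure_display} {T : measurableType disp} {R : realType}.
Variable P : probability T R.

Lemma probability_le_average (N : nat) (E : set T) (F : 'I_N -> set T) (q : R) :
  (0 < N)%N -> measurable E -> (forall j, measurable (F j)) ->
  (forall w, E w -> N%:R <= 2 * \sum_j (\1_(F j) w : R)) ->
  (forall j, P (F j) <= q%:E)%E -> (P E <= (2 * q)%:E)%E.
Proof.
move=> N0 mE mF EF Fq.
have m1 (A : set T) : measurable A -> measurable_fun setT (fun w => (\1_A w : R)%:E).
  by move=> mA; apply/measurable_EFinP; exact: measurable_indic.
have h : (N%:R%:E * P E <= 2%:E * \sum_(j < N) P (F j))%E.
  have -> : (N%:R%:E * P E = \int[P]_w (N%:R%:E * (\1_E w)%:E))%E.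
    by rewrite ge0_integralZl_EFin// ?integral_indic ?setIT//; exact: m1.
  have -> : (\sum_(j < N) P (F j) = \int[P]_w (\sum_(j < N) (\1_(F j) w)%:E))%E.
    rewrite ge0_integral_sum//; last by move=> j; exact: m1.
    by apply: eq_bigr => j _; rewrite integral_indic// setIT.
  rewrite -ge0_integralZl_EFin//; last 2 first.
  - by move=> w _; apply: sume_ge0 => j _; rewrite lee_fin.
  - by apply: emeasurable_sum => j; exact: m1.
  apply: ge0_le_integral => //.
  - by apply: measurable_funeM; exact: m1.
  - by apply: measurable_funeM; apply: emeasurable_sum => j; exact: m1.
  move=> w _; rewrite sumEFin -!EFinM lee_fin.
  have [Ew|nEw] := pselect (E w); first by rewrite indicE mem_set// mulr1; exact: EF.
  by rewrite [X in N%:R * X]indicE memNset// mulr0 mulr_ge0// sumr_ge0.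
have {}h : (N%:R%:E * P E <= 2%:E * (\sum_(j < N) q%:E))%E.
  by apply: le_trans h _; apply: lee_wpmul2l => //; exact: lee_sum.
move: h; rewrite sumEFin sumr_const card_ord -(fineK (fin_num_measure P E mE)).
rewrite -!EFinM !lee_fin => h.
have N0' : 0 < N%:R :> R by rewrite ltr0n.
by rewrite -(ler_pM2l N0') [leRHS]mulrCA [N%:R * q]mulr_natl.
Qed.

End Averaging.

Lemma sum_blocks (V : nmodType) (f : nat -> V) k N :
  \sum_(p < k * N) f p = \sum_(i < k) \sum_(j < N) f (i * N + j)%N.
Proof.
elim: k => [|k IH]; first by rewrite mul0n !big_ord0.
by rewrite mulSn addnC big_split_ord/= IH big_ord_recr.
Qed.

(** The first block is dropped, so that every retained time has [N] fresh innovations behind it. *)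
Lemma sum_blocks_le (R : numDomainType) (f : nat -> R) k N n :
  (forall p, 0 <= f p) -> (k.+1 * N <= n)%N ->
  \sum_(j < N) \sum_(i < k) f (i.+1 * N + j)%N <= \sum_(p < n) f p.
Proof.
move=> f0 kn; apply: (@le_trans _ _ (\sum_(p < k.+1 * N) f p)).
  rewrite sum_blocks big_ord_recl/= exchange_big/= lerDr.
  by apply: sumr_ge0.
rewrite (big_ord_widen n f kn) big_mkcond/=.
by apply: ler_sum => i _; case: ifP.
Qed.

Section QuadraticForm.
Context {disp : measure_display} {T : measurableType disp} {R : realType}.
Variable P : probability T R.
Variable eps : nat -> {RV P >-> R}.
Hypothesis eps_indep : independent_innovations eps.
Variables M alpha : R.
Hypotheses (M0 : 0 < M) (alpha0 : 0 < alpha).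
Hypothesis conc : forall (t : nat) (c : nat -> R) (lo h : R),
  0 < \sum_(s < t) c s ^+ 2 -> 0 < h ->
  (P [set w | (lo <= innov_form eps c t w <= lo + h)%R] <=
    (M * (h / Num.sqrt (\sum_(s < t) c s ^+ 2)) `^ alpha)%:E)%E.

Definition innov (w : T) : fps R := fshift (fun t => eps t w).

Lemma filter_innov_form (b : fps R) p w : b 0%N = 0 ->
  (b * innov w) p = innov_form eps (fun s => b (p - s)%N) p w.
Proof.
move=> b0; rewrite mulrC fpsM big_ord_recr/= subnn b0 mulr0 addr0.
by apply: eq_bigr => i _; rewrite mulrC.
Qed.

Lemma filter_innov_formS (b : fps R) p w :
  (b * innov w) p = innov_form eps (fun s => b (p - s)%N) p.+1 w.
Proof.
by rewrite mulrC fpsM; apply: eq_bigr => i _; rewrite mulrC.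
Qed.

Lemma measurable_filter (b : fps R) p : measurable_fun setT (fun w => (b * innov w) p).
Proof.
by under eq_fun do rewrite filter_innov_formS; exact: measurable_innov_form.
Qed.

Lemma measurable_sq_filter n (b : fps R) :
  measurable_fun setT (fun w => sq n (b * innov w)).
Proof.
by apply: measurable_sum => i; apply: measurable_funX; exact: measurable_filter.
Qed.

(* At the times j + N, j + 2N, ..., j + kN the values of the process are
   conditionally spread out; averaging over j < N makes the whole sum of
   squares, rather than only those k terms, small. *)
Lemma sq_small_ball (b : fps R) (n k N : nat) (V y : R) : b 0%N = 0 ->
  (0 < N)%N -> (k.+1 * N <= n)%N -> 0 < V -> V <= sq N.+1 b -> 0 < y ->
  (P [set w | (sq n (b * innov w) <= y)%R] <=
    (2 * (M * (3 * Num.sqrt (2 * y / N%:R) / Num.sqrt V) `^ alpha) ^+ k)%:E)%E.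
Proof.
move=> b0 N0 kN V0 hV y0.
have N0' : 0 < N%:R :> R by rewrite ltr0n.
(* An offset [j] with some value beyond [h] contributes at least h^2 = 2y / N to the sum of squares;
   a total of at most [y] leaves room for at most N / 2 such offsets. *)
pose h := Num.sqrt (2 * y / N%:R); have h0 : 0 < h by rewrite sqrtr_gt0 divr_gt0// mulr_gt0.
have h2 : h ^+ 2 = 2 * y / N%:R by rewrite sqr_sqrtr// ltW// divr_gt0// mulr_gt0.
pose tau j i := (i * N + j)%N.
pose F (j : 'I_N) := [set w | forall i, (i < k)%N ->
  (- h <= innov_form eps (fun s => b (tau j i.+1 - s)%N) (tau j i.+1) w <= h)%R].
have mF j : measurable (F j).
  rewrite (_ : F j = \bigcap_(i in [set i | (i < k)%N]) [set w | (- h <=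
      innov_form eps (fun s => b (tau j i.+1 - s)%N) (tau j i.+1) w <= h)%R]); last first.
    by apply/seteqP; split => w Fw i /=; exact: Fw.
  apply: bigcap_measurableType => i _.
  exact: measurable_innov_form_event (measurable_segment_set _ _).
apply: (@probability_le_average _ _ _ P N _ F) => //.
- rewrite -[X in measurable X]setTI.
  have := @measurable_sq_filter n b measurableT [set x | x <= y]; apply.
  by rewrite -set_itvNyc; exact: measurable_itv.
- move=> w /= wy.
  have bad (j : 'I_N) : 1 - \1_(F j) w <=
      (\sum_(i < k) ((b * innov w) (tau j i.+1)) ^+ 2) * (N%:R / (2 * y)).
    have S0 : 0 <= \sum_(i < k) ((b * innov w) (tau j i.+1)) ^+ 2.
      by apply: sumr_ge0 => i _; exact: sqr_ge0.
    have c0 : 0 <= N%:R / (2 * y) by rewrite divr_ge0// mulr_ge0// ltW.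
    have [Fw|nF] := pselect (F j w).
      by rewrite indicE mem_set// subrr mulr_ge0.
    rewrite indicE memNset// subr0.
    rewrite -[N%:R / _]invrK invf_div -h2 ler_pdivlMr ?exprn_gt0// mul1r.
    have [i ik hi] : exists2 i : nat, (i < k)%N &
        ~ (- h <= innov_form eps (fun s => b (tau j i.+1 - s)%N) (tau j i.+1) w <= h)%R.
      by apply: contrapT => nex; apply: nF => i ik; apply: contrapT => hi; apply: nex; exists i.
    rewrite (bigD1 (Ordinal ik))//=; apply: (@le_trans _ _ ((b * innov w) (tau j i.+1) ^+ 2)).
      rewrite filter_innov_form// -real_normK ?num_real// -[leRHS]real_normK ?num_real//.
      rewrite lerXn2r ?nnegrE//; move/negP: hi; rewrite -ler_norml -ltNge => /ltW.
      by rewrite gtr0_norm.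
    by rewrite lerDl sumr_ge0// => i' _; exact: sqr_ge0.
  have : \sum_(j < N) (1 - \1_(F j) w) <= sq n (b * innov w) * (N%:R / (2 * y)).
    apply: le_trans (ler_sum _ (fun j _ => bad j)) _.
    rewrite -mulr_suml; apply: ler_wpM2r; first by rewrite divr_ge0// mulr_ge0// ltW.
    exact: (@sum_blocks_le _ (fun p => (b * innov w) p ^+ 2) _ _ _ (fun p => sqr_ge0 _) kN).
  rewrite sumrB sumr_const card_ord.
  have : sq n (b * innov w) * (N%:R / (2 * y)) <= y * (N%:R / (2 * y)).
    by rewrite ler_wpM2r// divr_ge0// mulr_ge0// ltW.
  have -> : y * (N%:R / (2 * y)) = N%:R / 2 by field; rewrite gt_eqF.
  by lra.
move=> j; apply: (small_ball_chain eps_indep M0 alpha0 conc (tau := tau j)) => //.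
  by move=> i; rewrite /tau leq_add2r leq_mul2r leqnSn orbT.
move=> i ik; apply: (le_trans hV).
have -> : (tau j i.+1 = tau j i + N)%N by rewrite /tau mulSn; lia.
(* The [N] new innovations carry the coefficients b_N, ..., b_1; as b_0 = 0, their energy is the
   whole of [sq N.+1 b]. *)
rewrite /sq big_ord_recl/= b0 expr0n/= add0r.
rewrite -[X in \sum_(X <= _ < _) _]add0n big_addn addKn big_mkord.
rewrite [leRHS](reindex_inj rev_ord_inj)/=.
rewrite le_eqVlt; apply/orP; left; apply/eqP; apply: eq_bigr => s _.
congr (b _ ^+ 2); rewrite /bump/=; have := ltn_ord s; lia.
Qed.

End QuadraticForm.

(** * Mean of the envelope and Markov's inequality *)

Section GpotMean.
Context {disp : measure_display} {T : measurableType disp} {R : realType}.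
Variable P : probability T R.
Variable eps : nat -> {RV P >-> R}.
Variable sigma : R.
Hypothesis eps_indep : independent_innovations eps.
Hypothesis eps_mean : forall t, (1 <= t)%N -> ('E_P[eps t] = 0)%E.
Hypothesis eps_var : forall t, (1 <= t)%N ->
  ('E_P[fun w => (eps t w ^+ 2)%R] = (sigma ^+ 2)%:E)%E.
Local Notation frac h := (frac_coef h : fps R).
Local Notation ell n := (1 + ln n.+1%:R : R).

Lemma integral_sq_filter n (b : fps R) :
  (\int[P]_w (sq n (b * innov eps w))%:E <= (n%:R * (sigma ^+ 2 * sq n b))%:E)%E.
Proof.
rewrite /sq; under eq_integral do rewrite -sumEFin.
rewrite ge0_integral_sum//; last 2 first.
- move=> p; apply/measurable_EFinP; apply: measurable_funX; exact: measurable_filter.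
- by move=> p w _; rewrite lee_fin sqr_ge0.
have -> : n%:R * (sigma ^+ 2 * \sum_(i < n) b i ^+ 2) =
    \sum_(p < n) sigma ^+ 2 * \sum_(i < n) b i ^+ 2.
  by rewrite sumr_const card_ord mulr_natl.
rewrite -sumEFin; apply: lee_sum => p _.
under eq_integral do rewrite filter_innov_formS.
rewrite (integral_innov_form_sqr eps_indep eps_mean eps_var) lee_fin.
rewrite ler_wpM2l ?sqr_ge0//; apply: le_trans (le_sq b (ltn_ord p)).
rewrite [leRHS](reindex_inj rev_ord_inj)/= le_eqVlt; apply/orP; left; apply/eqP.
by apply: eq_bigr => i _; rewrite subSS.
Qed.

Lemma measurable_envelope J n : measurable_fun setT (fun w => envelope J n (innov eps w)).
Proof.
by apply: measurable_sum => i; apply: measurable_funM => //; exact: measurable_sq_filter.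
Qed.

Definition grid_size (M n : nat) : nat := (M * (Num.truncn (ell n)).+1 + 2)%N.

(** There are O(log n) grid points, and each normalized term has mean O(log n) by
    [sq_frac_upper]. *)
Lemma integral_envelope (M : nat) : exists2 C : R, 0 <= C & forall n,
  (\int[P]_w (envelope (grid_size M n) n (innov eps w))%:E <= (C * ell n ^+ 2)%:E)%E.
Proof.
pose g : R := 2 * M%:R + 3.
pose c := sigma ^+ 2 * (1 + g ^+ 2 * expR (2 * g)).
have g0 : 0 <= g by rewrite addr_ge0// mulr_ge0.
have c0 : 0 <= c by rewrite mulr_ge0 ?sqr_ge0// addr_ge0// mulr_ge0 ?sqr_ge0 ?expR_ge0.
exists ((2 * M%:R + 2) * c); first by rewrite mulr_ge0// addr_ge0// mulr_ge0.
move=> n; set J := grid_size M n; have l1' := ell_ge1 R n.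
have l0 : 0 < ell n by apply: lt_le_trans l1'.
have J2 : J%:R <= (2 * M%:R + 2) * ell n.
  rewrite /J /grid_size natrD natrM -[(Num.truncn _).+1%:R]natr1.
  have tl : (Num.truncn (ell n))%:R <= ell n by rewrite truncn_le ltW.
  have : M%:R * ((Num.truncn (ell n))%:R + 1) <= M%:R * (2 * ell n).
    by rewrite ler_wpM2l//; lra.
  by move=> ?; lra.
rewrite /envelope; under eq_integral do rewrite -sumEFin.
rewrite ge0_integral_sum//; last 2 first.
- move=> p; apply/measurable_EFinP; apply: measurable_funM => //; exact: measurable_sq_filter.
- by move=> p w _; rewrite lee_fin mulr_ge0 ?expR_ge0 ?sq_ge0.
apply: (@le_trans _ _ (\sum_(i < J) (c * ell n)%:E)%E); last first.
  rewrite sumEFin sumr_const card_ord lee_fin -[_ *+ J]mulr_natl.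
  rewrite [leRHS](_ : _ = (2 * M%:R + 2) * ell n * (c * ell n)); last by ring.
  by rewrite ler_wpM2r// mulr_ge0// ltW.
apply: lee_sum => i _; set k := grid R n i.
have kh : 2^-1 <= k by rewrite /k /grid lerDl divr_ge0// ltW.
have kg : k <= g.
  have : i%:R / ell n <= 2 * M%:R + 2.
    by rewrite ler_pdivrMr//; apply: le_trans J2; rewrite ler_nat ltnW.
  rewrite /k /grid /g; lra.
under eq_integral do rewrite EFinM.
rewrite ge0_integralZl_EFin ?expR_ge0//; last 2 first.
- by move=> w _; rewrite lee_fin sq_ge0.
- by apply/measurable_EFinP; exact: measurable_sq_filter.
apply: (@le_trans _ _ ((expR (- (2 * k * ln n.+1%:R)))%:E *
    (n.+1%:R * (sigma ^+ 2 * sq n.+1 (frac (- k))))%:E)%E).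
  by apply: lee_wpmul2l; rewrite ?lee_fin ?expR_ge0//; exact: integral_sq_filter.
rewrite -EFinM lee_fin.
have em : n.+1%:R = expR (ln n.+1%:R) :> R by rewrite lnK// posrE ltr0n.
have k0 : 0 <= k by apply: le_trans kh; rewrite invr_ge0.
apply: (@le_trans _ _ (sigma ^+ 2 * (1 + k ^+ 2 * expR (2 * k)) * ell n)).
  have h := sq_frac_upper n kh.
  set F := sq _ _ in h *; set A := 1 + _ in h *.
  rewrite [X in _ * (X * _) <= _]em [leLHS](_ : _ = expR (- (2 * k * ln n.+1%:R)) * expR (ln n.+1%:R) *
    sigma ^+ 2 * F); last by ring.
  have -> : expR (- (2 * k * ln n.+1%:R)) * expR (ln n.+1%:R) =
      (expR ((2 * k - 1) * ln n.+1%:R))^-1.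
    by rewrite -expRD -expRN; congr expR; ring.
  set E := expR _ in h *; have E0 : 0 < E by exact: expR_gt0.
  rewrite -mulrA ler_pdivrMl//.
  rewrite [leRHS](_ : _ = sigma ^+ 2 * (A * E * ell n)); last by ring.
  by rewrite ler_wpM2l ?sqr_ge0.
rewrite ler_wpM2r ?(ltW l0)// ler_wpM2l ?sqr_ge0// lerD2l.
apply: ler_pM; rewrite ?sqr_ge0 ?expR_ge0//.
  by rewrite lerXn2r ?nnegrE.
by rewrite ler_expR ler_wpM2l.
Qed.

Lemma markov_integral (X : T -> R) (lam c : R) : measurable_fun setT X ->
  (forall w, 0 <= X w) -> 0 < lam -> (\int[P]_w (X w)%:E <= c%:E)%E ->
  (P [set w | (lam < X w)%R] <= (c / lam)%:E)%E.
Proof.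
move=> mX X0 l0 Xc; set E := [set w | _].
have mE : measurable E.
  rewrite -[X in measurable X]setTI; apply: (mX measurableT [set x | lam < x]).
  by rewrite -set_itvoy; exact: measurable_itv.
have : (lam%:E * P E <= c%:E)%E.
  apply: le_trans Xc.
  have -> : (lam%:E * P E = \int[P]_w (lam%:E * (\1_E w)%:E))%E.
    rewrite ge0_integralZl_EFin ?(ltW l0)// ?integral_indic ?setIT//.
    by apply/measurable_EFinP; exact: measurable_indic.
  apply: ge0_le_integral => //.
  - by move=> w _; rewrite -EFinM lee_fin mulr_ge0// ltW.
  - by apply: measurable_funeM; apply/measurable_EFinP; exact: measurable_indic.
  - exact/measurable_EFinP.
  move=> w _; rewrite -EFinM lee_fin.
  have [Ew|nE] := pselect (E w); first by rewrite indicE mem_set// mulr1 ltW.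
  by rewrite indicE memNset// mulr0.
rewrite -(fineK (fin_num_measure P E mE)) -EFinM !lee_fin => h.
by rewrite ler_pdivlMr// mulrC.
Qed.

End GpotMean.

(** * The lower tail of the infimum *)

Section Core.
Variables (R : realType) (p1 p2 : nat).
Context {disp : measure_display} {T : measurableType disp}.
Variable P : probability T R.
Variables (sigma : R) (eps : nat -> {RV P >-> R}).
Variables (Pi : set 'rV[R]_(p1 + p2)) (L U : R) (eta0 : 'rV[R]_(p1 + p2 + 1)).
Hypothesis eps_indep : independent_innovations eps.
Hypothesis eps_mean : forall t, (1 <= t)%N -> ('E_P[eps t] = 0)%E.
Hypothesis eps_var : forall t, (1 <= t)%N ->
  ('E_P[fun w => (eps t w ^+ 2)%R] = (sigma ^+ 2)%:E)%E.
Hypothesis Pi_compact : compact Pi.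
Hypothesis Pi_adm : forall theta, Pi theta -> admissible theta.
Hypothesis eta0_in : param_space Pi L U eta0.
Hypothesis eps_A1 : condition_A1 eps.
Variable delta : R.
Hypothesis delta0 : 0 < delta.
Local Notation PD := (param_space Pi L U).
Local Notation K := (PD `\` eball eta0 delta).
Local Notation ell n := (1 + ln n.+1%:R : R).
Local Notation an n eta := (expR (2 * mem_exp eta0 eta * ln n.+1%:R)).

Lemma probability_bigsetU_le (I : eqType) (s : seq I) (F : I -> set T) (q : R) :
  (forall i, measurable (F i)) -> (forall i, i \in s -> P (F i) <= q%:E)%E ->
  measurable (\big[setU/set0]_(i <- s) F i) /\
  (P (\big[setU/set0]_(i <- s) F i) <= ((size s)%:R * q)%:E)%E.
Proof.
move=> mF; elim: s => [|i s IH] Fq; first by rewrite big_nil measure0 mul0r.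
have [|mU PU] := IH; first by move=> j js; apply: Fq; rewrite inE js orbT.
rewrite big_cons; split; first exact: measurableU.
apply: le_trans (measureU2 _ _ _) _ => //.
rewrite /= -natr1 mulrDl mul1r addrC EFinD; apply: leeD => //.
by apply: Fq; rewrite inE eqxx.
Qed.

(** For blocks of length N near n / (k + 1), the level a_n / (zN) divided by the block energy N^(2
    [mem_exp] - 1) is of order (k + 1)^(2 [mem_exp]) / z: the powers of n cancel. (A1) sees the
    square root of this ratio, hence the halved exponent. *)
Lemma point_small_ball : exists alpha : R, 0 < alpha /\
  forall (k : nat) (kmax C1 : R), 0 < C1 -> exists2 D : R, 0 <= D & exists n0 : nat,
  forall eta n z, K eta -> mem_exp eta0 eta <= kmax -> (n0 <= n)%N -> 1 <= z ->
  (P [set w | (sq n.+1 ((resid_filter eta0 eta - 1) * innov eps w) <= an n eta * (C1 / z))%R] <=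
    (D * z^-1 `^ (alpha * k%:R))%:E)%E.
Proof.
have [M [alpha [M0 a0 conc]]] := innov_form_concentration eps_A1.
exists (alpha / 2); split; first by rewrite divr_gt0.
move=> k kmax C1 C10.
have [c [m0 c0 hV]] := resid_filter_energy_lower Pi_compact Pi_adm eta0_in delta0.
(* Here 9 is the square of the 3 from the cells, 4 combines the 2 of the threshold with N + 1 <= 2N,
   and the exponential comes from n + 1 <= (k + 1)(N + 1). *)
pose D0 := 9 * (4 * C1 * expR (2 * kmax * ln k.+1%:R) / c).
have D00 : 0 < D0 by rewrite mulr_gt0// divr_gt0// !mulr_gt0// expR_gt0.
exists (2 * (M * D0 `^ (alpha / 2)) ^+ k).
  by rewrite mulr_ge0// exprn_ge0// mulr_ge0 ?powR_ge0// ltW.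
exists (k.+1 * m0.+1)%N => eta n z Ke kk hn z1.
have z0 : 0 < z by apply: lt_le_trans z1.
pose N := (n.+1 %/ k.+1)%N.
have Nm : (m0 < N)%N by rewrite /N leq_divRL// mulnC ltnW.
have N0 : (0 < N)%N by apply: leq_trans Nm.
have kN : (k.+1 * N <= n.+1)%N by rewrite mulnC leq_trunc_div.
set E := an n eta; have E0 : 0 < E by exact: expR_gt0.
pose V := c * expR ((2 * mem_exp eta0 eta - 1) * ln N.+1%:R).
have V0 : 0 < V by rewrite mulr_gt0// expR_gt0.
have hVN : V <= sq N.+1 (resid_filter eta0 eta - 1) by apply: hV => //; exact: ltnW.
pose y := E * (C1 / z); have y0 : 0 < y by rewrite !mulr_gt0// invr_gt0.
have b0 : (resid_filter eta0 eta - 1) 0%N = 0 by rewrite fpsB resid_filter0 fps1 subrr.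
apply: le_trans (sq_small_ball eps_indep M0 a0 conc b0 N0 kN V0 hVN y0) _.
have N0' : 0 < N%:R :> R by rewrite ltr0n.
have ratio : 9 * (2 * y / N%:R / V) <= D0 / z.
  rewrite /D0 -[leRHS]mulrA ler_pM2l//.
  rewrite ler_pdivrMr// ler_pdivrMr//.
  rewrite /y [leLHS](_ : _ = (2 * C1 / z) * E); last by ring.
  rewrite [leRHS](_ : _ = (2 * C1 / z) * (2 * expR (2 * kmax * ln k.+1%:R) *
    (expR ((2 * mem_exp eta0 eta - 1) * ln N.+1%:R) * N%:R))); last first.
    by rewrite /V; field; rewrite gt_eqF//= gt_eqF.
  rewrite ler_pM2l ?divr_gt0 ?mulr_gt0//.
  apply: (@le_trans _ _ (expR (2 * kmax * ln k.+1%:R) *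
      (expR ((2 * mem_exp eta0 eta - 1) * ln N.+1%:R) * N.+1%:R))); last first.
    rewrite [leRHS](_ : _ = expR (2 * kmax * ln k.+1%:R) *
      (expR ((2 * mem_exp eta0 eta - 1) * ln N.+1%:R) * (2 * N%:R))); last by ring.
    rewrite ler_pM2l ?expR_gt0// ler_pM2l ?expR_gt0//.
    by rewrite -natrM ler_nat mul2n -addnn -addn1 leq_add2l.
  have em : N.+1%:R = expR (ln N.+1%:R) :> R by rewrite lnK// posrE ltr0n.
  rewrite [X in _ <= _ * (_ * X)]em -!expRD /E ler_expR.
  set k' := mem_exp _ _ in kk *.
  have k'0 : 0 <= k' by rewrite /k' /mem_exp le_max invr_ge0 ler0n.
  have lnn : ln n.+1%:R <= ln k.+1%:R + ln N.+1%:R :> R.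
    rewrite -lnM ?posrE ?ltr0n// ler_ln ?posrE ?ltr0n ?mulr_gt0 ?ltr0n//.
    by rewrite -natrM ler_nat mulnC ltnW// ltn_ceil.
  have h1 : k' * ln n.+1%:R <= k' * (ln k.+1%:R + ln N.+1%:R) by rewrite ler_wpM2l.
  have h2 : k' * ln k.+1%:R <= kmax * ln k.+1%:R.
    by rewrite ler_wpM2r// ln_ge0// ler1n.
  by move: h1 h2; rewrite mulrDr; lra.
have zi : 0 <= z^-1 by rewrite invr_ge0 ltW.
rewrite lee_fin -[leRHS]mulrA ler_pM2l//.
have -> : z^-1 `^ (alpha / 2 * k%:R) = (z^-1 `^ (alpha / 2)) ^+ k.
  by rewrite powRrM powR_mulrn ?powR_ge0.
rewrite -exprMn lerXn2r ?nnegrE ?mulr_ge0 ?powR_ge0 ?(ltW M0)//.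
rewrite -[leRHS]mulrA ler_pM2l// -powRM ?(ltW D00)//.
have -> : (D0 * z^-1) `^ (alpha / 2) = Num.sqrt (D0 / z) `^ alpha.
  by rewrite [alpha / 2]mulrC powRrM powR12_sqrt// divr_ge0// ltW.
apply: ge0_ler_powR; [exact: ltW| | |].
- by rewrite nnegrE divr_ge0 ?mulr_ge0 ?sqrtr_ge0.
- by rewrite nnegrE sqrtr_ge0.
have -> : 3 * Num.sqrt (2 * y / N%:R) / Num.sqrt V = Num.sqrt (9 * (2 * y / N%:R / V)).
  have -> : 9 = 3 ^+ 2 :> R by ring.
  rewrite [RHS]sqrtrM ?sqr_ge0// sqrtr_sqr ger0_norm// -mulrA; congr (_ * _).
  have y2 : 0 <= 2 * y / N%:R by rewrite divr_ge0// mulr_ge0// ltW.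
  by rewrite [RHS]sqrtrM// sqrtrV// ltW.
exact: ler_wsqrtr.
Qed.

Variable y : nat -> {RV P >-> R}.
Hypothesis y_model : forall w, arfima eta0 (fun t => y t w) (fun t => eps t w).

(* The net of mesh 1/(ell^2 z^(Q+1)) has only polylogarithmically many points,
   so a fixed number [k] of conditioning times beats its cardinality once
   [z] exceeds a power of log n. *)
Lemma scaled_inf_tail (Q J : nat) : exists2 C : R, 0 <= C & exists n0 : nat,
  forall n z, (n0 <= n)%N -> 1 <= z -> ell n <= 2 * z ^+ J ->
  exists E : set T, [/\ measurable E, (P E <= (C * z^-1 ^+ Q)%:E)%E &
    forall w, (scaled_inf K eta0 (fun t => y t w) n.+1 < (z^-1)%:E)%E -> E w].
Proof.
have [M hM [Cg Cg0 hG]] := envelope_bound Pi L U eta0.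
have [C1 C10 hC1] := resid_filter_transfer Pi_compact Pi_adm eta0_in Cg0 hG.
have [CE CE0 hCE] := integral_envelope eps_indep eps_mean eps_var M.
have cPD := @param_space_compact R p1 p2 Pi L U Pi_compact.
have [B hB] := compact_coord_bounded cPD.
have [alpha [a0 hball]] := point_small_ball.
pose mm := (p1 + p2 + 1)%N.
(* The inverse mesh is at most 4 z^e because 1 + ln (n + 1) <= 2 z^J, so the net has O(z^(e mm))
   points; [W] adds the decay z^(-Q) that must survive the union bound. *)
pose e := (2 * J + Q.+1)%N.
pose W := (e * mm + Q)%N.
pose k := (Num.truncn (W%:R / alpha)).+1.
have kW : W%:R <= alpha * k%:R.
  by rewrite mulrC -ler_pdivrMr// ltW// truncnS_gt.
have [|D D0 [n0 hD]] := hball k (M%:R + 2^-1) (2 * (C1 + 1)).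
  by rewrite mulr_gt0// ltr_wpDl.
exists (CE + ((2 * B%:R + 1) * 4) ^+ mm * D).
  by rewrite addr_ge0// mulr_ge0// exprn_ge0// mulr_ge0// addr_ge0// mulr_ge0.
exists n0 => n z nn z1 lz.
have z0 : 0 < z by apply: lt_le_trans z1.
have l1' := ell_ge1 R n; have l0 : 0 < ell n by apply: lt_le_trans l1'.
(* By Markov the envelope exceeds [lam] with probability O(z^(-Q)). Below [lam], the mesh 1 / [ri]
   makes the transfer error at most z^(-Q - 2) <= 1/z. *)
pose lam := ell n ^+ 2 * z ^+ Q; pose ri := ell n ^+ 2 * z ^+ Q.+1.
have lam0 : 0 < lam by rewrite mulr_gt0 ?exprn_gt0.
have ri1 : 1 <= ri by rewrite -[leLHS]mulr1 ler_pM// exprn_ege1.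
have ri0 : 0 < ri by apply: lt_le_trans ri1.
have r01 : 0 < ri^-1 <= 1 by rewrite invr_gt0 ri0 invf_le1.
have hBK x : K x -> forall j, `|x 0 j| <= B%:R by move=> [Kx _]; exact: hB.
have [s [sK snet ssz]] := finite_net hBK r01.
pose G w := envelope (@grid_size R M n) n (innov eps w).
pose F eta := [set w | sq n.+1 ((resid_filter eta0 eta - 1) * innov eps w) <=
   an n eta * (2 * (C1 + 1) / z)].
have mF eta : measurable (F eta).
  rewrite -[X in measurable X]setTI.
  have := @measurable_sq_filter _ _ _ P eps n.+1 (resid_filter eta0 eta - 1) measurableT
    [set x | x <= an n eta * (2 * (C1 + 1) / z)]; apply.
  by rewrite -set_itvNyc; exact: measurable_itv.
have Fq eta : eta \in s -> (P (F eta) <= (D * z^-1 `^ (alpha * k%:R))%:E)%E.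
  move=> es; apply: hD => //; first exact: sK.
  by have := hM _ (sK _ es).1; lra.
have [mU PU] := probability_bigsetU_le mF Fq.
have mG : measurable_fun setT G by exact: measurable_envelope.
have mE1 : measurable [set w | lam < G w].
  rewrite -[X in measurable X]setTI; apply: (mG measurableT [set x | lam < x]).
  by rewrite -set_itvoy; exact: measurable_itv.
exists ([set w | lam < G w] `|` \big[setU/set0]_(i <- s) F i); split.
- exact: measurableU.
- apply: le_trans (measureU2 _ _ _) _ => //.
  rewrite mulrDl EFinD; apply: leeD.
    apply: le_trans (markov_integral mG _ lam0 (hCE n)) _.
      by move=> w; exact: envelope_ge0.
    rewrite lee_fin /lam [leLHS](_ : _ = CE * (z ^+ Q)^-1).
      by rewrite exprVn.
    by field; rewrite !gt_eqF ?exprn_gt0.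
  apply: le_trans PU _; rewrite lee_fin.
  have zk : z^-1 `^ (alpha * k%:R) <= z^-1 ^+ W.
    rewrite -powR_mulrn ?invr_ge0 ?(ltW z0)//; apply: ger_powR => //.
    by rewrite invr_gt0 z0 invf_le1.
  have sz : (size s)%:R <= ((2 * B%:R + 1) * 4) ^+ mm * z ^+ (e * mm).
    apply: le_trans ssz _; rewrite invrK [((2 * B%:R + 1) * 4) ^+ mm]exprMn -[leRHS]mulrA.
    apply: ler_wpM2l; first by rewrite exprn_ge0// addr_ge0// mulr_ge0.
    rewrite exprM -exprMn lerXn2r ?nnegrE ?(ltW ri0)// ?mulr_ge0 ?exprn_ge0 ?(ltW z0)//.
    rewrite /ri /e mulnC exprD mulrA; apply: ler_wpM2r; first by rewrite exprn_ge0 ?ltW.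
    rewrite exprM (_ : 4 = 2 ^+ 2); last by ring.
    by rewrite -exprMn lerXn2r ?nnegrE ?mulr_ge0 ?exprn_ge0 ?(ltW l0) ?(ltW z0).
  apply: (@le_trans _ _ (((2 * B%:R + 1) * 4) ^+ mm * z ^+ (e * mm) * (D * z^-1 ^+ W))).
    apply: ler_pM => //; first by rewrite mulr_ge0 ?powR_ge0.
    by rewrite ler_wpM2l.
  rewrite /W exprD le_eqVlt; apply/orP; left; apply/eqP.
  rewrite [z^-1 ^+ (e * mm)]exprVn; field.
  by rewrite !gt_eqF ?exprn_gt0.
move=> w /ereal_inf_lt[_ [eta Keta <-]].
rewrite lte_fin (residual_sq _ _ (y_model w)) rateE ltr_pdivrMl ?expR_gt0// => hlt.
have [lG|Gl] := ltP lam (G w); [by left|right].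
have [eta' es ee'] := snet _ Keta.
rewrite -bigcup_seq; exists eta' => //.
apply: le_trans (hC1 eta eta' ri^-1 n (@grid_size R M n) (innov eps w) Keta.1 (sK _ es).1
  (leqnn _) ee' _ z^-1 (ltW hlt)) _.
  rewrite mulrC ler_pdivrMr// mul1r /ri; apply: (@le_trans _ _ (ell n * ell n)).
    by rewrite ler_peMl// ltW.
  by rewrite -expr2 ler_peMr ?exprn_ege1// exprn_ge0// ltW.
rewrite ler_pM2l ?expR_gt0//.
have q1 : (ri^-1 * ell n) ^+ 2 * G w <= z^-1.
  apply: (@le_trans _ _ ((ri^-1 * ell n) ^+ 2 * lam)).
    by rewrite ler_wpM2l ?sqr_ge0.
  rewrite [leLHS](_ : _ = (z ^+ Q * z ^+ 2)^-1); last first.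
    have zQ : z ^+ Q != 0 by rewrite expf_neq0// gt_eqF.
    rewrite /ri /lam [z ^+ Q.+1]exprS; move: (z ^+ Q) zQ => u u0.
    by field; rewrite u0 !gt_eqF.
  rewrite lef_pV2 ?posrE ?mulr_gt0 ?exprn_gt0// expr2 mulrA.
  by rewrite ler_peMl ?(ltW z0)// -[leLHS]mulr1 ler_pM ?exprn_ege1.
apply: (@le_trans _ _ (C1 * (2 * z^-1))).
  by rewrite ler_wpM2l// mulr_natl mulr2n lerD2l.
rewrite mulrCA mulrA ler_wpM2r ?invr_ge0 ?(ltW z0)//.
by rewrite ler_wpM2l// lerDl.
Qed.

End Core.

(** * Inverse moments *)

Section InverseMoment.
Context {disp : measure_display} {T : measurableType disp} {R : realType}.
Variable P : probability T R.
Local Open Scope ereal_scope.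

(* The integral of a non-measurable function is a lower integral, hence still
   monotone. *)
Lemma le_integral_lower (f h : T -> \bar R) : (forall w, 0 <= f w) ->
  (forall w, f w <= h w) -> \int[P]_w f w <= \int[P]_w h w.
Proof.
move=> f0 fh; have h0 w : 0 <= h w by apply: le_trans (fh w).
rewrite !ge0_integralTE//; apply: le_ereal_sup => _ [g gf <-].
by exists g => // w; apply: le_trans (fh w); exact: gf.
Qed.

(** At the first level l where [E l] fails, I >= 1 / z_l and the inverse moment is at most z_l^q.
    This is L^q for l = 0 and is otherwise charged to [E (l - 1)], whence the weights z_(l+1)^q.
    Their expected sum is geometric because Q >= q + 1. *)
Lemma inverse_moment_of_tail (I : T -> \bar R) (q L C : R) (Q : nat)
    (E : nat -> set T) :
  (0 < q)%R -> (q + 1 <= Q%:R)%R -> (1 <= L)%R -> (0 <= C)%R ->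
  (forall w, 0 <= I w) -> (forall l, measurable (E l)) ->
  (forall l, P (E l) <= (C * ((L * 2 ^+ l)^-1) ^+ Q)%:E) ->
  (forall l w, I w < ((L * 2 ^+ l)^-1)%:E -> E l w) ->
  \int[P]_w (I w `^ q)^-1 <= (L `^ q + 2 `^ q * (2 * C))%:E.
Proof.
move=> q0 qQ L1 C0 I0 mE PE IE.
pose z l : R := (L * 2 ^+ l)%R.
have z0 l : (0 < z l)%R by rewrite mulr_gt0 ?exprn_gt0// (lt_le_trans ltr01).
have z1 l : (1 <= z l)%R by rewrite -[leLHS]mulr1 ler_pM// exprn_ege1// ler1n.
have zS l : z l.+1 = (2 * z l)%R by rewrite /z exprS mulrCA.
pose a l : R := (z l.+1 `^ q)%R.
have a0 l : (0 <= a l)%R by exact: powR_ge0.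
have a1 l : (1 <= a l)%R.
  apply: (@le_trans _ _ (1 `^ q)%R); first by rewrite powR1.
  by apply: ge0_ler_powR; rewrite ?nnegrE ?(ltW q0)// ltW.
pose h w : \bar R := (L `^ q)%:E + \sum_(l <oo) ((a l)%:E * (\1_(E l) w)%:E).
have t0 l w : 0 <= (a l)%:E * (\1_(E l) w)%:E by rewrite -EFinM lee_fin mulr_ge0.
have term l w : E l w -> (a l)%:E <= h w.
  move=> El; rewrite /h -[leLHS]add0e; apply: leeD; first by rewrite lee_fin powR_ge0.
  have := @nneseries_lim_ge R (fun l => (a l)%:E * (\1_(E l) w)%:E) xpredT 0 l.+1
    (fun l _ _ => t0 l w).
  apply: le_trans; rewrite big_nat_recr//= indicE mem_set// mule1.
  by rewrite leeDr// sume_ge0.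
have Ifin l w : ~ E l w -> (I w `^ q)^-1 <= (z l `^ q)%:E.
  move=> nE; have : ((z l)^-1)%:E <= I w.
    by rewrite leNgt; apply/negP => /IE.
  case: (I w) => [r| |//]; last first.
    by move=> _; rewrite poweRyr ?gt_eqF// invey lee_fin powR_ge0.
  rewrite lee_fin poweR_EFin => rz.
  have r0 : (0 < r)%R by apply: lt_le_trans rz; rewrite invr_gt0.
  rewrite inver gt_eqF ?powR_gt0// lee_fin -[leLHS]mul1r ler_pdivrMr ?powR_gt0//.
  rewrite -powRM ?(ltW (z0 l)) ?(ltW r0)//.
  have zr : (1 <= z l * r)%R by rewrite mulrC -ler_pdivrMr ?div1r.
  apply: (@le_trans _ _ (1 `^ q)%R); first by rewrite powR1.
  by apply: ge0_ler_powR; rewrite ?nnegrE ?(ltW q0)// (le_trans ler01).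
have fh w : (I w `^ q)^-1 <= h w.
  have [[l nEl]|allE] := pselect (exists l, ~ E l w); last first.
    have Ew l : E l w by apply: contrapT => nEl; apply: allE; exists l.
    (* If every [E l] occurs, [I w] may be 0 and the majorant has to be infinite; each of its terms
       is at least 1. *)
    suff -> : h w = +oo by exact: leey.
    apply: eq_infty => r; pose N := Num.truncn r.
    apply: (@le_trans _ _ (\sum_(0 <= l < N.+1) (a l)%:E * (\1_(E l) w)%:E)); last first.
      rewrite /h -[leLHS]add0e; apply: leeD; first by rewrite lee_fin powR_ge0.
      by apply: nneseries_lim_ge => k _ _; exact: t0.
    apply: (@le_trans _ _ (\sum_(0 <= l < N.+1) 1)).
      by rewrite sumEFin lee_fin sumr_const_nat subn0 ltW// truncnS_gt.
    by apply: lee_sum => l _; rewrite indicE mem_set// mule1 lee_fin.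
  have exl : exists l, ~~ `[< E l w >] by exists l; apply/asboolPn.
  have := ex_minnP exl; case: ex_minnP => m /asboolPn nEm mmin _.
  apply: le_trans (Ifin _ _ nEm) _; case: m nEm mmin => [|m] nEm mmin.
    rewrite /z expr0 mulr1 /h leeDl//; apply: nneseries_ge0 => k _ _; exact: t0.
  apply: (term m); apply: contrapT => nE.
  by have /asboolPn/mmin := nE; rewrite ltnn.
apply: le_trans (le_integral_lower _ fh) _.
  by move=> w; rewrite inve_ge0 poweR_ge0.
have mt l : measurable_fun setT (fun w => (a l)%:E * (\1_(E l) w)%:E).
  by apply: measurable_funeM; apply/measurable_EFinP; exact: measurable_indic.
rewrite /h ge0_integralD//; last 3 first.
- by move=> w _; rewrite lee_fin powR_ge0.
- by move=> w _; apply: nneseries_ge0 => k _ _; exact: t0.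
- by apply: ge0_emeasurable_sum.
have -> : \int[P]_(_ in [set: T]) (L `^ q)%:E = (L `^ q)%:E.
  rewrite integral_cst// -[RHS]mule1; congr (_ * _); exact: probability_setT.
rewrite EFinD leeD2l//.
rewrite integral_nneseries//.
apply: (@le_trans _ _ (\sum_(l <oo) ((2 `^ q * (2 * C)) / (2 ^ l.+1)%N%:R)%:E)); last first.
  by apply: epsilon_trick0; rewrite mulr_ge0 ?powR_ge0// mulr_ge0.
apply: lee_nneseries => [l _ _|l _].
  by apply: integral_ge0 => w _; exact: t0.
rewrite ge0_integralZl_EFin//; last by apply/measurable_EFinP; exact: measurable_indic.
rewrite integral_indic// setIT.
apply: (@le_trans _ _ ((a l)%:E * (C * (z l)^-1 ^+ Q)%:E)).
  by apply: lee_wpmul2l; rewrite ?lee_fin//; exact: PE.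
rewrite -EFinM lee_fin /a zS powRM ?(ltW (z0 l))// -[leLHS]mulrA -[leRHS]mulrA ler_wpM2l ?powR_ge0//.
have zq : (z l `^ q * (z l)^-1 ^+ Q <= (z l)^-1)%R.
  case: Q qQ {PE} => [|Q'] qQ; first by exfalso; lra.
  rewrite exprS mulrCA ler_piMr ?invr_ge0 ?(ltW (z0 l))//.
  rewrite exprVn ler_pdivrMr ?exprn_gt0// mul1r -powR_mulrn ?(ltW (z0 l))//.
  by apply: ler_powR => //; move: qQ; rewrite -natr1; lra.
rewrite mulrCA [leRHS](_ : _ = (C * (2 ^+ l)^-1)%R).
  rewrite ler_wpM2l//; apply: le_trans zq _.
  rewrite lef_pV2 ?posrE ?exprn_gt0// /z ler_peMl ?exprn_ge0//.
rewrite natrX exprS; field.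
by rewrite expf_neq0// pnatr_eq0.
Qed.

End InverseMoment.

Theorem lemma2p1 (R : realType) (p1 p2 : nat)
    (disp : measure_display) (T : measurableType disp) (P : probability T R)
    (sigma : R) (eps y : nat -> {RV P >-> R})
    (Pi : set 'rV[R]_(p1 + p2)) (L U : R) (eta0 : 'rV[R]_(p1 + p2 + 1))
    (eps_indep : independent_innovations eps)
    (eps_mean : forall t, (1 <= t)%N -> ('E_P[eps t] = 0)%E)
    (eps_var : forall t, (1 <= t)%N ->
       ('E_P[fun w => (eps t w ^+ 2)%R] = (sigma ^+ 2)%:E)%E)
    (LU : L < U)
    (Pi_compact : compact Pi)
    (Pi_adm : forall theta, Pi theta -> admissible theta)
    (eta0_in : param_space Pi L U eta0)
    (y_model : forall w, arfima eta0 (fun t => y t w) (fun t => eps t w))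
    (eps_A1 : condition_A1 eps)
    (delta : R) (delta_gt0 : 0 < delta)
    (K_neq0 : param_space Pi L U `\` eball eta0 delta !=set0)
    (q kappa : R) (q_gt0 : 0 < q) (kappa_gt0 : 0 < kappa) :
  exists C : R, \forall n \near \oo,
    (\int[P]_w ((scaled_inf (param_space Pi L U `\` eball eta0 delta) eta0
                  (fun t => y t w) n) `^ q)^-1
     <= (C * ln n%:R `^ kappa)%:E)%E.
Proof.
(* [J] makes the J-th power of (log n)^(kappa/q) at least log n, as the tail estimate requires; [Q]
   makes the dyadic series summable. *)
pose J := (Num.truncn (q / kappa)).+1; pose Q := (Num.truncn q).+2.
have qQ : q + 1 <= Q%:R by rewrite -natr1 lerD2r ltW// truncnS_gt.
have Jk : 1 <= kappa / q * J%:R.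
  rewrite mulrAC ler_pdivlMr// mul1r mulrC -ler_pdivrMr//.
  by rewrite ltW// truncnS_gt.
have [C C0 [n0 tail]] := scaled_inf_tail eps_indep eps_mean eps_var Pi_compact
  Pi_adm eta0_in eps_A1 delta_gt0 y_model Q J.
exists (1 + 2 `^ q * (2 * C)).
(* Beyond [n1] the logarithm is at least 1, so the starting level and the final rate are too. *)
pose n1 := (maxn n0 (Num.truncn (expR 1 : R)).+1).+1.
exists n1 => // n /= n1n.
case: n n1n => // n; rewrite /n1 ltnS geq_max => /andP[n0n en].
have ln1 : 1 <= ln n.+1%:R :> R.
  rewrite -[leLHS]expRK ler_ln ?posrE ?expR_gt0 ?ltr0n// ltW//.
  by apply: lt_le_trans (truncnS_gt _) _; rewrite ler_nat leqW.
have ln0 : 0 <= ln n.+1%:R :> R by apply: le_trans ln1.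
pose Lq : R := ln n.+1%:R `^ (kappa / q).
have Lq1 : 1 <= Lq.
  apply: (@le_trans _ _ (1 `^ (kappa / q))); first by rewrite powR1.
  by apply: ge0_ler_powR; rewrite ?nnegrE// divr_ge0// ltW.
have LqJ : ln n.+1%:R <= Lq ^+ J.
  rewrite /Lq -powR_mulrn ?powR_ge0// -powRrM -[leLHS]powRr1//.
  exact: ler_powR.
have Lqq : Lq `^ q = ln n.+1%:R `^ kappa.
  by rewrite /Lq -powRrM divfK// gt_eqF.
have z1 l : 1 <= Lq * 2 ^+ l by rewrite -[leLHS]mulr1 ler_pM// exprn_ege1// ler1n.
have lz l : 1 + ln n.+1%:R <= 2 * (Lq * 2 ^+ l) ^+ J.
  have : ln n.+1%:R <= (Lq * 2 ^+ l) ^+ J.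
    apply: le_trans LqJ _; rewrite lerXn2r ?nnegrE ?(le_trans ler01)//.
    by rewrite ler_peMr ?(le_trans ler01)// exprn_ege1// ler1n.
  by lra.
have /choice[E hE] l := tail n _ n0n (z1 l) (lz l).
apply: le_trans (@inverse_moment_of_tail _ _ _ P _ q Lq C Q E _ _ _ _ _ _ _ _) _ => //.
- move=> w; apply: le_ereal_inf_tmp => _ [eta _ <-]; rewrite lee_fin mulr_ge0//.
    by rewrite invr_ge0 rateE expR_ge0.
  by apply: sumr_ge0 => t _; exact: sqr_ge0.
- by move=> l; case: (hE l).
- by move=> l; case: (hE l).
- by move=> l w; case: (hE l) => _ _; apply.
rewrite lee_fin Lqq [leRHS]mulrDl mul1r lerD2l ler_peMr//.
  by rewrite mulr_ge0 ?powR_ge0// mulr_ge0.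
apply: (@le_trans _ _ (1 `^ kappa)); first by rewrite powR1.
by apply: ge0_ler_powR; rewrite ?nnegrE// ltW.
Qed.
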